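(* Let $Z=Z_T$ be the terminal state-price density, $w_0$ the initial wealth, $B$ the upper bound on terminal wealth, $\kappa\in(1/2,1)$, $\alpha\in\mathbb R$ fixed with $-\alpha>0$ and $B+\alpha>0$, and $K\in\mathbb R$. Consider the problem $$(P)\qquad \min_{M\in L^2(\Omega,\mathcal F_T,\mathbb P)} -\mathbb E[M]\quad\text{s.t.}\quad \mathbb E\big[M+\alpha+(1-\kappa)^{-1}(-M-\alpha)^+\big]\le K,\quad \mathbb E[ZM]=w_0,\quad 0\le M\le B.$$ For multipliers $\lambda\ge 0$ and $\eta$ put $$C_1=\Big\{Z\le \tfrac{1-\lambda}{\eta}\Big\},\quad C_2=\Big\{\tfrac{1-\lambda}{\eta}< Z\le \tfrac{\lambda((1-\kappa)^{-1}-1)+1}{\eta}\Big\},\quad C_3=\Big\{\tfrac{\lambda((1-\kappa)^{-1}-1)+1}{\eta}<Z\Big\},$$ $$M^*=B\,\mathbf 1_{C_1}-\alpha\,\mathbf 1_{C_2}+0\times\mathbf 1_{C_3}.$$ For $p\in\{0,1\}$ define $H_p(y)=\mathbb E[Z^p\mathbf 1_{\{Z\le y\}}]$, and let $$\underline K=\begin{cases}-\alpha\big(1-(1-\kappa)^{-1}\big)\Big(H_0\big(H_1^{-1}(\tfrac{w_0}{-\alpha})\big)-1\Big), & w_0<-\alpha\,\mathbb E[Z],\\[2pt] (B+\alpha)\,H_0\Big(H_1^{-1}\big(\tfrac{w_0+\alpha\mathbb E[Z]}{B+\alpha}\big)\Big), & w_0\ge -\alpha\,\mathbb E[Z],\end{cases}$$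 $$\overline K=B\,H_0\big(H_1^{-1}(w_0/B)\big)-\alpha\Big((1-\kappa)^{-1}\big(1-H_0(H_1^{-1}(w_0/B))\big)-1\Big).$$ Then the solution of $(P)$ satisfies the following. (i) If $\underline K<K<\overline K$, then $M^*$ solves $(P)$, and there is a unique pair $0<\lambda<1$, $\eta>0$ satisfying the conditions $$B\,\mathbb P(C_1)-\alpha\,\mathbb P(C_2)-\alpha(1-\kappa)^{-1}\mathbb P(C_3)\le K-\alpha,\qquad B\,\mathbb E[Z\mathbf 1_{C_1}]-\alpha\,\mathbb E[Z\mathbf 1_{C_2}]=w_0,$$ with equality holding in the first one. (ii) If $K=\underline K$ and $w_0=-\alpha\,\mathbb E[Z]$, then there exists a unique solution to $(P)$. This solution corresponds to a portfolio consisting solely of the risk-free asset. (iii) If $K=\underline K$ and $w_0<-\alpha\,\mathbb E[Z]$, then $M^*$ solves $(P)$ with $\lambda=1$ and $\eta=\dfrac{1}{(1-\kappa)H_1^{-1}\left(\frac{w_0}{-\alpha}\right)}$. (iv) If $K=\underline K$ and $w_0>-\alpha\,\mathbb E[Z]$, then $M^*$ solves $(P)$ with $\dfrac{1-\lambda}{\eta}=H_1^{-1}\left(\dfrac{w_0+\alpha\mathbb E[Z]}{B+\alpha}\right)$ and $\dfrac{\lambda((1-\kappa)^{-1}-1)+1}{\eta}=+\infty$. (v) If $K=\overline K$, then $M^*$ solves $(P)$ with $\lambda=0$ and $\eta=1/H_1^{-1}(w_0/B)$.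
   Context: Market: on a complete filtered probability space $(\Omega,\mathcal A,\mathbb P,\mathbb F=(\mathcal F_t)_{0\le t\le T})$, with $\mathbb F$ the completed natural filtration of an $n$-dimensional Brownian motion $W$ (independent components), there is a risk-free asset $dS^0_t=r_tS^0_t\,dt$ and $n$ risky assets $dS^i_t=S^i_t(\mu^i_t\,dt+\sum_{j}\sigma^{ij}_t\,dW^j_t)$, with positive initial prices. The processes $r,\mu^i,\sigma^{ij}$ are $\mathbb F$-adapted ($r$ predictable) and uniformly bounded, and $\sigma_t\sigma_t^\top\succ\epsilon I$ for all $t\in[0,T]$ a.s., for some constant $\epsilon>0$. The market is complete. Let $b_t=(\mu^1_t-r_t,\dots,\mu^n_t-r_t)^\top$ and $\theta_t=\sigma_t^{-1}b_t$. The state-price density is $$Z_t=\exp\Big(-\int_0^t\big(r_s+\tfrac12\|\theta_s\|^2\big)ds-\int_0^t\theta_s^\top dW_s\Big),\qquad Z:=Z_T.$$ A random variable $M$ feasible for $(P)$ is a terminal wealth, replicated by a self-financing portfolio with initial wealth $w_0$. Notation: $x^+=\max(x,0)$; $H_1^{-1}$ is the inverse function of $H_1$.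
   Formalization: In (ii) the solution is shown to be −α a.s.; that the risk-free asset alone replicates it is claimed only if S⁰_T is a.s. constant (false for random S⁰_T). H_1 is assumed a bijection [0,∞)→[0,E[Z)), 0<w_0<B E[Z], and adapted coefficients are taken progressively measurable. *)

(* Defs.v *)
From HB Require Import structures.
From mathcomp Require Import all_boot all_order all_algebra.
From mathcomp Require Import all_classical all_reals all_analysis.

Set Implicit Arguments.
Unset Strict Implicit.
Unset Printing Implicit Defensive.

Import Order.TTheory GRing.Theory Num.Theory.
Import numFieldNormedType.Exports.

Local Open Scope classical_set_scope.
Local Open Scope ring_scope.

Section linear_algebra.
Context {R : realType} {n : nat}.

Definition vdot (u v : 'cV[R]_n) : R := \sum_(i < n) u i 0 * v i 0.

Definition sqnorm (u : 'cV[R]_n) : R := vdot u u.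

(* Used for sigma sigma^T - eps I only, where symmetry is automatic. *)
Definition posdefmx (A : 'M[R]_n) : Prop :=
  forall x : 'cV[R]_n, x != 0 -> 0 < (x^T *m A *m x) 0 0.

End linear_algebra.

Section processes.
Context {R : realType} {d : measure_display} {Omega : measurableType d}.
Implicit Types (F : R -> set (set Omega)) (X : R -> Omega -> R).

Definition measurable_wrt (G : set (set Omega)) (f : Omega -> R) : Prop :=
  forall B : set R, measurable B -> G (f @^-1` B).

(* X restricted to [0, t] x Omega is B(R) (x) F_t - measurable for all t <= T *)
Definition progressive F (T : R) X : Prop :=
  forall t, 0 <= t <= T -> forall B : set R, measurable B ->
    <<s [set S : set (R * Omega) | exists A : set R, exists C : set Omega,
           [/\ measurable A, F t C & S = A `*` C]] >>
    [set z : R * Omega | 0 <= z.1 <= t /\ B (X z.1 z.2)].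

Definition predictable F (T : R) X : Prop :=
  forall B : set R, measurable B ->
    <<s [set S : set (R * Omega) |
           (exists2 C, F 0 C & S = [set 0] `*` C) \/
           (exists s t C, [/\ 0 <= s < t, t <= T, F s C
                            & S = `]s, t]%classic `*` C])] >>
    [set z : R * Omega | 0 <= z.1 <= T /\ B (X z.1 z.2)].

End processes.

Section stochastic_calculus.
Context {R : realType} {d : measure_display} {Omega : measurableType d}.
Variables (P : probability Omega R) (T : R) (n : nat).
Implicit Types (W phi : R -> Omega -> 'cV[R]_n).

Definition brownian_filtration W (t : R) : set (set Omega) :=
  <<s [set A : set Omega | exists s i (B : set R),
         [/\ 0 <= s <= t, measurable B & A = (fun w => W s w i 0) @^-1` B]]
      `|` [set N : set Omega | P.-negligible N] >>.

(* The product formula says that W_t - W_s is independent of F_s and that its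
   components are independent with law N(0, t - s); [normal_prob] takes the
   standard deviation. *)
Definition brownian_motion W : Prop :=
  [/\ forall t i, measurable_fun setT (fun w => W t w i 0),
      {ae P, forall w, W 0 w = 0},
      {ae P, forall w, forall i,
         {within `[0, T], continuous (fun t => W t w i 0)}}
    & forall (s t : R) (A : set Omega) (B : 'I_n -> set R),
        0 <= s -> s < t -> t <= T ->
        brownian_filtration W s A -> (forall i, measurable (B i)) ->
        P (A `&` [set w | forall i, B i (W t w i 0 - W s w i 0)]) =
        (P A * \prod_(i < n) normal_prob 0 (Num.sqrt (t - s)) (B i))%E].

(* sum over k < size of val_k 1_{]time_k, time_{k+1}]} *)
Record simple_process := SimpleProcess {
  sp_size : nat;
  sp_time : nat -> R;
  sp_val : nat -> Omega -> 'cV[R]_n }.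

Definition simple_adapted (F : R -> set (set Omega)) (h : simple_process) :=
  [/\ forall k, (k <= sp_size h)%N -> 0 <= sp_time h k <= T,
      forall k, (k < sp_size h)%N -> sp_time h k <= sp_time h k.+1,
      forall k i, (k < sp_size h)%N ->
        measurable_wrt (F (sp_time h k)) (fun w => sp_val h k w i 0)
    & exists c : R, forall k w i, (k < sp_size h)%N ->
        `|sp_val h k w i 0| <= c].

Definition simple_path (h : simple_process) (s : R) (w : Omega) : 'cV[R]_n :=
  \sum_(k < sp_size h)
    (\1_(`]sp_time h k, sp_time h k.+1]%classic) s : R) *: sp_val h k w.

Definition simple_integral W (h : simple_process) (t : R) (w : Omega) : R :=
  \sum_(k < sp_size h)
    vdot (sp_val h k w)
         (W (Num.min (sp_time h k.+1) t) w - W (Num.min (sp_time h k) t) w).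

(* I is (a version of) the Ito integral of phi . dW over [0, t]: the L^2(P)
   limit of the integrals of simple processes converging to phi in
   L^2(P (x) ds). *)
Definition ito_integral W phi (t : R) (I : Omega -> R) : Prop :=
  let F := brownian_filtration W in
  [/\ forall i, progressive F T (fun s w => phi s w i 0),
      measurable_wrt (F t) I
    & exists h : nat -> simple_process,
        [/\ forall m, simple_adapted F (h m),
            ((fun m => \int[P]_w \int[lebesgue_measure]_(s in `[0%R, t])
                (sqnorm (simple_path (h m) s w - phi s w))%:E) @ \oo --> 0)%E
          & ((fun m => \int[P]_w
                ((simple_integral W (h m) t w - I w) ^+ 2)%:E) @ \oo --> 0)%E]].

End stochastic_calculus.

Section market.
Context {R : realType} {d : measure_display} {Omega : measurableType d}.

Record market (P : probability Omega R) (T : R) (n : nat) := Market {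
  mkt_W : R -> Omega -> 'cV[R]_n;
  mkt_r : R -> Omega -> R;
  mkt_mu : R -> Omega -> 'cV[R]_n;
  mkt_sigma : R -> Omega -> 'M[R]_n;
  mkt_S0 : R -> Omega -> R;
  mkt_S : R -> Omega -> 'cV[R]_n;
  mkt_F := brownian_filtration P mkt_W;
  mkt_T_gt0 : 0 < T;
  mkt_complete : measure_is_complete P;
  mkt_brownian : brownian_motion P T mkt_W;
  mkt_r_pred : predictable mkt_F T mkt_r;
  mkt_mu_prog : forall i, progressive mkt_F T (fun t w => mkt_mu t w i 0);
  mkt_sigma_prog :
    forall i j, progressive mkt_F T (fun t w => mkt_sigma t w i j);
  mkt_bounded : exists c : R, forall t w, 0 <= t <= T ->
    [/\ `|mkt_r t w| <= c, forall i, `|mkt_mu t w i 0| <= c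
      & forall i j, `|mkt_sigma t w i j| <= c];
  mkt_elliptic : exists2 eps : R, 0 < eps &
    {ae P, forall w, forall t, 0 <= t <= T ->
       posdefmx (mkt_sigma t w *m (mkt_sigma t w)^T - eps%:M)};
  (* dS0 = r S0 dt *)
  mkt_S0_prog : progressive mkt_F T mkt_S0;
  mkt_S0_cont :
    {ae P, forall w, {within `[0, T], continuous (fun t => mkt_S0 t w)}};
  mkt_S0_dyn : exists2 s0 : R, 0 < s0 &
    {ae P, forall w, forall t, 0 <= t <= T -> mkt_S0 t w =
       s0 + \int[lebesgue_measure]_(s in `[0, t]) (mkt_r s w * mkt_S0 s w)};
  (* dS^i = S^i (mu^i dt + sum_j sigma^ij dW^j) *)
  mkt_S_prog : forall i, progressive mkt_F T (fun t w => mkt_S t w i 0);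
  mkt_S_cont : {ae P, forall w, forall i,
    {within `[0, T], continuous (fun t => mkt_S t w i 0)}};
  mkt_S_dyn : forall i, exists2 si : R, 0 < si &
    forall t, 0 <= t <= T -> exists2 I : Omega -> R,
      ito_integral P T mkt_W
        (fun s w => \col_j (mkt_S s w i 0 * mkt_sigma s w i j)) t I &
      {ae P, forall w, mkt_S t w i 0 =
         si + \int[lebesgue_measure]_(s in `[0, t])
                (mkt_S s w i 0 * mkt_mu s w i 0) + I w} }.

Context {P : probability Omega R} {T : R} {n : nat}.
Implicit Type mkt : market P T n.

Definition excess_return mkt (t : R) (w : Omega) : 'cV[R]_n :=
  \col_i (mkt_mu mkt t w i 0 - mkt_r mkt t w).

Definition price_of_risk mkt (t : R) (w : Omega) : 'cV[R]_n :=
  invmx (mkt_sigma mkt t w) *m excess_return mkt t w.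

Definition state_price_density mkt (Z : R -> Omega -> R) : Prop :=
  forall t, 0 <= t <= T -> exists2 I : Omega -> R,
    ito_integral P T (mkt_W mkt) (price_of_risk mkt) t I &
    {ae P, forall w, Z t w = expR
      (- (\int[lebesgue_measure]_(s in `[0, t])
            (mkt_r mkt s w + 2^-1 * sqnorm (price_of_risk mkt s w))) - I w)}.

(* A portfolio holds phi0 units of the risk-free asset and phi^i units of the
   i-th risky asset. *)
Definition wealth mkt (phi0 : R -> Omega -> R) (phi : R -> Omega -> 'cV[R]_n)
    (t : R) (w : Omega) : R :=
  phi0 t w * mkt_S0 mkt t w + vdot (phi t w) (mkt_S mkt t w).

(* drift of phi0 dS0 + sum_i phi^i dS^i *)
Definition gains_drift mkt (phi0 : R -> Omega -> R)
    (phi : R -> Omega -> 'cV[R]_n) (s : R) (w : Omega) : R :=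
  phi0 s w * (mkt_r mkt s w * mkt_S0 mkt s w) +
  \sum_(i < n) phi s w i 0 * (mkt_S mkt s w i 0 * mkt_mu mkt s w i 0).

(* dW^j-coefficients of sum_i phi^i dS^i *)
Definition gains_diffusion mkt (phi : R -> Omega -> 'cV[R]_n)
    (s : R) (w : Omega) : 'cV[R]_n :=
  \col_j \sum_(i < n)
    phi s w i 0 * (mkt_S mkt s w i 0 * mkt_sigma mkt s w i j).

Definition self_financing mkt (x : R) (phi0 : R -> Omega -> R)
    (phi : R -> Omega -> 'cV[R]_n) : Prop :=
  [/\ progressive (mkt_F mkt) T phi0,
      forall i, progressive (mkt_F mkt) T (fun t w => phi t w i 0),
      {ae P, forall w, lebesgue_measure.-integrable `[0, T]
         (fun s => (gains_drift mkt phi0 phi s w)%:E)},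
      {ae P, forall w, wealth mkt phi0 phi 0 w = x}
    & forall t, 0 <= t <= T -> exists2 I : Omega -> R,
        ito_integral P T (mkt_W mkt) (gains_diffusion mkt phi) t I &
        {ae P, forall w, wealth mkt phi0 phi t w =
           x + \int[lebesgue_measure]_(s in `[0, t])
                 gains_drift mkt phi0 phi s w + I w}].

End market.

Section problem.
Context {R : realType} {d : measure_display} {Omega : measurableType d}.
Variables (P : probability Omega R) (Z : Omega -> R).

Definition feasible (FT : set (set Omega)) (w0 B kappa alpha K : R)
    (M : Omega -> R) : Prop :=
  [/\ M \in Lfun P 2%:E /\ measurable_wrt FT M,
      ('E_P[fun w => (M w + alpha +
                      (1 - kappa)^-1 * Num.max (- M w - alpha) 0)%R] <= K%:E)%E,
      ('E_P[fun w => (Z w * M w)%R] = w0%:E)%E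
    & {ae P, forall w, 0 <= M w <= B}].

Definition solves (FT : set (set Omega)) (w0 B kappa alpha K : R)
    (M : Omega -> R) : Prop :=
  feasible FT w0 B kappa alpha K M /\
  forall M', feasible FT w0 B kappa alpha K M' ->
    (- 'E_P[M] <= - 'E_P[M'])%E.

(* The thresholds a and b are extended reals so that b = +oo is allowed. *)
Definition C1 (a : \bar R) : set Omega := [set w | (Z w)%:E <= a]%E.
Definition C2 (a b : \bar R) : set Omega := [set w | a < (Z w)%:E <= b]%E.
Definition C3 (b : \bar R) : set Omega := [set w | b < (Z w)%:E]%E.

Definition Mstar (B alpha : R) (a b : \bar R) (w : Omega) : R :=
  B * \1_(C1 a) w - alpha * \1_(C2 a b) w + 0 * \1_(C3 b) w.

Definition lower_threshold (lambda eta : R) : \bar R :=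
  ((1 - lambda) / eta)%:E.

Definition upper_threshold (kappa lambda eta : R) : \bar R :=
  ((lambda * ((1 - kappa)^-1 - 1) + 1) / eta)%:E.

Definition risk_value (B kappa alpha : R) (a b : \bar R) : \bar R :=
  (B%:E * P (C1 a) - alpha%:E * P (C2 a b)
   - (alpha * (1 - kappa)^-1)%:E * P (C3 b))%E.

Definition budget_value (B alpha : R) (a b : \bar R) : \bar R :=
  (B%:E * 'E_P[fun w => (Z w * \1_(C1 a) w)%R]
   - alpha%:E * 'E_P[fun w => (Z w * \1_(C2 a b) w)%R])%E.

Definition multiplier_conditions (w0 B kappa alpha K lambda eta : R) : Prop :=
  let a := lower_threshold lambda eta in
  let b := upper_threshold kappa lambda eta in
  (risk_value B kappa alpha a b <= (K - alpha)%:E)%E /\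
  budget_value B alpha a b = w0%:E.

Definition EZ : R := fine 'E_P[Z].

Definition H (p : nat) (y : R) : R :=
  fine 'E_P[fun w => Z w ^+ p * \1_[set w' | Z w' <= y] w].

(* H_1 is a bijection from [0, +oo[ onto [0, E[Z][, so that H_1^-1 makes
   sense.  [EZ] is 0 if E[Z] = +oo, so this includes E[Z] < +oo. *)
Definition H1_invertible : Prop :=
  set_bij `[0, +oo[%classic `[0, EZ[%classic (H 1).

Definition H1inv : R -> R := 'pinv_(fun=> 0) `[0, +oo[%classic (H 1).

Definition K_lower (w0 B kappa alpha : R) : R :=
  if w0 < - alpha * EZ then
    - alpha * (1 - (1 - kappa)^-1) * (H 0 (H1inv (w0 / - alpha)) - 1)
  else (B + alpha) * H 0 (H1inv ((w0 + alpha * EZ) / (B + alpha))).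

Definition K_upper (w0 B kappa alpha : R) : R :=
  B * H 0 (H1inv (w0 / B))
  - alpha * ((1 - kappa)^-1 * (1 - H 0 (H1inv (w0 / B))) - 1).

End problem.

(* Main.v *)
From HB Require Import structures.
Require Import Defs.
From mathcomp Require Import all_boot all_order all_algebra.
From mathcomp Require Import all_classical all_reals all_analysis.
From mathcomp Require Import measurable_realfun ring lra.
Import Order.TTheory GRing.Theory Num.Theory.
Import numFieldNormedType.Exports.
Local Open Scope classical_set_scope.
Local Open Scope ring_scope.

Set Implicit Arguments.
Unset Strict Implicit.
Unset Printing Implicit Defensive.

(** Minimizing - E[M] is a convex problem with a convex risk constraint and a
linear budget constraint.  Apart from the last claim of (ii), the market enters
it only through the law of the state-price density Z.  Put
c = 1 / (1 - kappa) > 1 and loss m = m + alpha + c (- m - alpha)^+, a convex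
piecewise linear function with slopes 1 - c and 1 and a kink at - alpha.

Optimality is Lagrangian duality.  For 0 <= lambda <= 1 and eta > 0 the
function - m + lambda loss m + eta Z m is minimized over 0 <= m <= B, state by
state, by the three-level wealth M* ([three_step_minimizes]).  Integrating and
using complementary slackness shows that M* is optimal as soon as it is
feasible ([duality_solves]); this gives the optimality of M* in (i), (iii) and
(v).  In (ii) and (iv) no finite multiplier is available, but loss m >=
m + alpha bounds the mean of every feasible wealth by K - alpha, and a wealth
that stays above - alpha and saturates the risk constraint attains the bound
([solves_of_binding_risk]).  In (ii), K = 0 and loss vanishes at - alpha only, which
gives uniqueness.

The multipliers in (i) correspond bijectively to thresholds 0 < a < b, and
the two conditions read
(B + alpha) H1 a - alpha H1 b = w0 and
(B + alpha) H0 a - alpha (c - 1) (1 - H0 b) = K.  Along the solutions of the first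
one, b decreases when a increases, so the left-hand side of the second is
strictly increasing in a: this is uniqueness ([thresholds_unique]).  Its
limits at the two ends of the admissible range of a are the lower and the upper
bound on K, so existence is the intermediate value theorem.  Continuity holds
in the variable u = H1 y: by the two inequalities
y (H0 y' - H0 y) <= H1 y' - H1 y and y (1 - H0 y) <= E[Z] - H1 y, the function
H0 is a Lipschitz function of H1 away from 0 ([H0_of_H1_lipschitz]).

The last claim of (ii) says that holding w0 / S0_0 units of the risk-free asset
replicates the constant - alpha when S0_T is a constant C.  As w0 = - alpha E[Z],
this amounts to E[Z] C = S0_0 ([riskless_price]).  Now S0_T is S0_0 times the
exponential of the integral of r ([bank_accountE]), hence Z C is S0_0 times
the exponential of - int theta dW - 1/2 int |theta|^2, and the claim is that
this exponential has expectation 1 ([integral_ito_exponential]).  Uniform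
ellipticity bounds theta ([posdef_price_bound]).  For simple integrands the
expectation is 1 by conditioning on the past of each increment
([integral_simple_exponential]).  For the limit, simple approximations of theta are
stopped when their energy exceeds a fixed level; the exponentials then have
bounded second moments, and convergence of the exponents in a weak sense is
enough ([integral_exp_limit]). *)

(** * Functions on a time strip *)

Section product_sections.
Context d (X : measurableType d) (R : realType) (T : R).
Let U : measurableType _ := measurableTypeR R.
Let D : set (U * X) := `[0, T]%classic `*` setT.

Let mD : measurable D.
Proof. by apply: measurableX => //; exact: measurable_itv. Qed.

Let restrictE (f : U * X -> \bar R) s w :
  ((f \_ D) (s, w) = ((fun s : U => f (s, w)) \_ (`[0%R, T]%classic : set U)) s)%E.
Proof.
rewrite !patchE; have [sT|sT] := boolP (s \in `[0, T]%classic).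
  by rewrite (_ : (s, w) \in D)// inE; split => //=; move: sT; rewrite inE.
rewrite ifN//; apply: contra sT; rewrite !inE => -[]//.
Qed.

Lemma measurable_section_itv d' (V : measurableType d') (f : U * X -> V) w :
  measurable_fun D f -> measurable_fun (`[0, T]%classic : set U) (fun s => f (s, w)).
Proof.
move=> mf _ E mE; have := mf mD E mE => mDE.
rewrite [X in measurable X](_ : _ = (fun s => (s, w)) @^-1` (D `&` f @^-1` E)).
  by rewrite -[X in measurable X]setTI; exact: (@pair2_measurable _ _ U X w).
by apply/seteqP; split => s /=; [move=> [? ?]; do !split|move=> [[? _] ?]].
Qed.

(** Tonelli, after extending the integrand by 0 outside the strip. *)
Lemma measurable_integral_itv (f : U * X -> \bar R) :
  measurable_fun D f -> (forall z, D z -> 0 <= f z)%E ->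
  measurable_fun setT (fun w => \int[lebesgue_measure]_(s in `[0%R, T]) f (s, w))%E.
Proof.
move=> mf f0.
have mg : measurable_fun setT (f \_ D).
  by have [+ _] := @measurable_restrictT _ _ _ _ _ f mD; exact.
have g0 z : (0 <= (f \_ D) z)%E.
  by rewrite patchE; case: ifPn => //; rewrite inE => /f0.
rewrite [X in measurable_fun _ X](_ : _ = @fubini_G _ _ U X R lebesgue_measure (f \_ D)); last first.
  apply/funext => w; rewrite /fubini_G [LHS]integral_mkcond; apply: eq_integral => s _.
  by rewrite restrictE.
exact: (@measurable_fun_fubini_tonelli_G _ _ U X R lebesgue_measure (f \_ D) mg g0).
Qed.

(** The positive and the negative part are integrated separately, and the
real-valued integral is a measurable function of the two integrals. *)
Lemma measurable_Rintegral_itv (f : U * X -> R) :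
  measurable_fun D f ->
  measurable_fun setT (fun w => \int[lebesgue_measure]_(s in `[0, T]) f (s, w)).
Proof.
move=> mf.
have mEf : measurable_fun D (EFin \o f) by exact/measurable_EFinP.
rewrite /Rintegral; apply: (measurableT_comp (@fine_measurable R _ measurableT)) => //.
rewrite [X in measurable_fun _ X](_ : _ = fun w =>
  \int[lebesgue_measure]_(s in `[0%R, T]) ((EFin \o f)^\+)%E (s, w) -
  \int[lebesgue_measure]_(s in `[0%R, T]) ((EFin \o f)^\-)%E (s, w))%E; last first.
  apply/funext => w; rewrite [LHS]integralE; congr (_ - _)%E; apply: eq_integral => s _;
    by rewrite ?funeposE ?funenegE.
apply: emeasurable_funB.
- by apply: measurable_integral_itv => //; exact: measurable_funepos.
- by apply: measurable_integral_itv => //; exact: measurable_funeneg.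
Qed.

End product_sections.

(** * The Brownian filtration *)

Section brownian_filtration_theory.
Context {R : realType} {d : measure_display} {Omega : measurableType d}.
Variables (P : probability Omega R) (T : R) (n : nat) (W : R -> Omega -> 'cV[R]_n).

(** Naming the generators makes the sigma-algebra of the filtration at time t that
of a measurable type, to which Fubini and the theory of measurable functions
apply. *)
Definition brownian_generators (t : R) : set (set Omega) :=
  [set A : set Omega | exists s i (B : set R),
     [/\ 0 <= s <= t, measurable B & A = (fun w => W s w i 0) @^-1` B]]
  `|` [set N : set Omega | P.-negligible N].

Local Notation F := (brownian_filtration P W).
Local Notation Om t := (g_sigma_algebraType (brownian_generators t)).

Lemma brownian_filtration_measurable (t : R) :
  measure_is_complete P -> (forall s i, measurable_fun setT (fun w => W s w i 0)) ->
  F t `<=` measurable.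
Proof.
move=> cP mW; apply: smallest_sub; first exact: sigma_algebra_measurable.
move=> A [[s [i [B [_ mB ->]]]]|/cP//].
by rewrite -[X in measurable X]setTI; exact: mW.
Qed.

Lemma brownian_filtration_mono (s t : R) : s <= t -> F s `<=` F t.
Proof.
move=> st; apply: sub_smallest2r; first exact: smallest_sigma_algebra.
move=> A [[u [i [B [/andP[u0 us] mB ->]]]]|Nn].
  by left; exists u, i, B; split => //; rewrite u0 (le_trans us).
by right.
Qed.

Lemma measurable_wrtP (t : R) (f : Omega -> R) :
  measurable_wrt (F t) f <-> measurable_fun (setT : set (Om t)) f.
Proof.
split=> [mf _ B mB|mf B mB]; first by rewrite setTI; exact: mf.
by have := mf measurableT B mB; rewrite setTI.
Qed.

Lemma measurable_W (s t : R) i : 0 <= s <= t ->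
  measurable_fun (setT : set (Om t)) (fun w => W s w i 0).
Proof.
move=> st _ B mB; rewrite setTI; apply: sub_sigma_algebra; left.
by exists s, i, B.
Qed.

Lemma measurable_wrt_mono (s t : R) (f : Omega -> R) : s <= t ->
  measurable_wrt (F s) f -> measurable_fun (setT : set (Om t)) f.
Proof. by move=> st mf; apply/measurable_wrtP => B mB; apply: brownian_filtration_mono (mf B mB). Qed.

(** The filtration contains all negligible sets, so that measurability only
depends on the class of a function modulo P. *)
Lemma measurable_wrt_ae (t : R) (f g : Omega -> R) :
  {ae P, forall w, f w = g w} -> measurable_wrt (F t) g -> measurable_wrt (F t) f.
Proof.
move=> [N [mN PN fgN]] mg B mB.
have negF A : A `<=` N -> F t A.
  by move=> AN; apply: sub_sigma_algebra; right; exists N.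
have FC : F t (~` N) by apply: sigma_algebraC; exact: negF.
rewrite (_ : f @^-1` B = ((g @^-1` B) `&` ~` N) `|` (f @^-1` B `&` N)).
  apply: (@measurableU _ (Om t)); last by apply: negF => w [].
  by apply: (@measurableI _ (Om t)); [exact: mg|].
apply/seteqP; split => w /=; have [Nw|Nw] := pselect (N w).
- by move=> ?; right.
- by move=> Bfw; left; split => //; rewrite -(_ : f w = g w)//; apply: contrapT => /fgN.
- by move=> [[]//|[]].
- move=> [[Bgw _]|[]//]; rewrite (_ : f w = g w)//; apply: contrapT => /fgN//.
Qed.

Let U : measurableType _ := measurableTypeR R.
Local Notation strip := (`[0, T]%classic `*` setT).

Lemma progressive_measurable (X : R -> Omega -> R) : 0 <= T ->
  progressive F T X ->
  measurable_fun (strip : set (U * Om T)) (fun z => X z.1 z.2).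
Proof.
move=> T0 pX _ B mB.
have /pX/(_ B mB) : 0 <= T <= T by rewrite T0 lexx.
rewrite (_ : strip `&` _ = [set z : R * Omega | 0 <= z.1 <= T /\ B (X z.1 z.2)]); last first.
  apply/seteqP; split => -[s w] /=; rewrite in_itv/=; first by move=> [[? _] ?].
  by move=> [? ?]; split.
apply: smallest_sub; first exact: (@sigma_algebra_measurable _ (U * Om T)%type).
by move=> _ [A [C [mA FC ->]]]; exact: (@measurableX _ _ U (Om T)).
Qed.

Lemma predictable_measurable (X : R -> Omega -> R) : 0 <= T ->
  predictable F T X ->
  measurable_fun (strip : set (U * Om T)) (fun z => X z.1 z.2).
Proof.
move=> T0 pX _ B mB.
have := pX B mB.
rewrite (_ : strip `&` _ = [set z : R * Omega | 0 <= z.1 <= T /\ B (X z.1 z.2)]); last first.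
  apply/seteqP; split => -[s w] /=; rewrite in_itv/=; first by move=> [[? _] ?].
  by move=> [? ?]; split.
apply: smallest_sub; first exact: (@sigma_algebra_measurable _ (U * Om T)%type).
move=> _ [[C FC ->]|[s [t [C [/andP[s0 st] tT FC ->]]]]].
  by apply: (@measurableX _ _ U (Om T)); [exact: measurable_set1|exact: (brownian_filtration_mono T0)].
apply: (@measurableX _ _ U (Om T)); first exact: measurable_itv.
by apply: brownian_filtration_mono FC; rewrite (le_trans (ltW st)).
Qed.

(** Measurability with respect to the information at T is what the definition of
Z requires; the integrals with respect to P live on the full sigma-algebra. *)
Lemma strip_measurable (f : U * Omega -> R) : F T `<=` measurable ->
  measurable_fun (strip : set (U * Om T)) f ->
  measurable_fun (strip : set (U * Omega)) f.
Proof.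
move=> FT mf _ B mB; have mS : measurable (strip : set (U * Om T)).
  by apply: (@measurableX _ _ U (Om T)) => //; exact: measurable_itv.
have := mf mS B mB.
rewrite measurable_prod_measurableType; apply: smallest_sub.
  exact: sigma_algebra_measurable.
move=> _ [A mA [C mC <-]]; apply: measurableX => //; exact: FT.
Qed.

End brownian_filtration_theory.

(** * Gaussian increments independent of the past *)

Section density.
Local Open Scope ereal_scope.
Context d (X : measurableType d) (R : realType).
Variables (mu nu : {measure set X -> \bar R}) (f : X -> R).
Hypotheses (mf : measurable_fun setT f) (f0 : forall x, (0 <= f x)%R).
Hypothesis nuE : forall A, measurable A -> nu A = \int[mu]_(x in A) (f x)%:E.

Import HBNNSimple.

Lemma ge0_integral_density (g : X -> \bar R) :
  measurable_fun setT g -> (forall x, 0 <= g x) ->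
  \int[nu]_x g x = \int[mu]_x (g x * (f x)%:E).
Proof.
move=> mg g0.
have mEf : measurable_fun setT (EFin \o f) by exact/measurable_EFinP.
pose g_ := nnsfun_approx measurableT mg.
have gcvg x : (g_ n x)%:E @[n --> \oo] --> g x by exact: cvg_nnsfun_approx.
transitivity (limn (fun n => \int[nu]_x (g_ n x)%:E)).
  rewrite -monotone_convergence//.
  - by apply: eq_integral => y _; apply/esym/cvg_lim.
  - by move=> n; exact/measurable_EFinP/measurable_funP.
  - by move=> n y _; rewrite lee_fin.
  - by move=> y _ m n mn; rewrite lee_fin; exact/lefP/nd_nnsfun_approx.
rewrite [X in limn X](_ : _ = (fun n => \int[mu]_x ((g_ n x)%:E * (f x)%:E))).
  rewrite -monotone_convergence//.
  - apply: eq_integral => x _; apply/cvg_lim => //.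
    exact: cvgeZr.
  - move=> n; apply: emeasurable_funM => //.
    exact/measurable_EFinP/measurable_funP.
  - by move=> n x _; rewrite mule_ge0// lee_fin.
  - move=> x _ m n mn; apply: lee_pmul => //; rewrite lee_fin//.
    exact/lefP/nd_nnsfun_approx.
apply/funext => n.
have mfr r : measurable (g_ n @^-1` [set r]) by [].
transitivity (\sum_(k \in range (g_ n))
    \int[nu]_x (k * \1_(g_ n @^-1` [set k]) x)%:E).
  under eq_integral do rewrite fimfunE -fsumEFin//.
  rewrite ge0_integral_fsum//.
  - by move=> y; exact/measurable_EFinP/measurable_funM.
  - by move=> y x _; rewrite nnfun_muleindic_ge0.
transitivity (\int[mu]_x (\sum_(k \in range (g_ n))
    (k * \1_(g_ n @^-1` [set k]) x * f x)%:E)); last first.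
  apply: eq_integral => x _; rewrite [in RHS]fimfunE -EFinM.
  by rewrite fsumEFin// mulr_fsuml.
rewrite ge0_integral_fsum//; last 2 first.
- move=> y; apply/measurable_EFinP/measurable_funM => //.
  exact: measurable_funM.
- move=> y x _; rewrite EFinM mule_ge0//; first by rewrite nnfun_muleindic_ge0.
  by rewrite lee_fin.
apply: eq_fsbigr => r _; rewrite integralZl_indic_nnsfun// integral_indic//=.
rewrite setIT nuE// integral_mkcond.
have [r0|r0] := ltP r 0%R.
  rewrite preimage_nnfun0// patch_set0 integral_cst// mul0e mule0.
  by rewrite integral0_eq// => x _; rewrite indic0 mulr0 mul0r.
rewrite -ge0_integralZl//.
- apply: eq_integral => x _; rewrite patchE/= indicE.
  by case: ifPn => _; rewrite ?mule0 ?mulr0 ?mul0r ?mulr1 ?EFinM.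
- have := @measurable_restrictT _ _ _ _ _ (EFin \o f) (mfr r); move=> [+ _]; apply; exact: measurable_funTS.
- by move=> x _; rewrite patchE; case: ifPn; rewrite ?lee_fin.
Qed.
End density.

Section normal_mgf.
Context {R : realType}.

(** Completing the square: multiplying the density of N(0, s^2) by this exponential
gives the density of N(- v s^2, s^2). *)
Lemma integral_normal_exp (v s : R) : 0 < s ->
  (\int[normal_prob 0 s]_x (expR (- (v * x) - 2^-1 * (v ^+ 2 * s ^+ 2)))%:E = 1)%E.
Proof.
move=> s0.
rewrite (@ge0_integral_density _ _ R lebesgue_measure (normal_prob 0 s)
  (normal_pdf 0 s)) //=; first last.
- apply/measurable_EFinP; apply: measurableT_comp => //.
  apply: measurable_funB => //; apply: measurableT_comp => //.
- by move=> x; exact: normal_pdf_ge0.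
- exact: measurable_normal_pdf.
rewrite -[RHS](@integral_normal_pdf R (- (v * s ^+ 2)) s).
apply: eq_integral => x _; rewrite -EFinM; congr EFin.
rewrite !normal_pdfE ?gt_eqF// mulrCA; congr *%R.
rewrite /normal_fun -expRD; congr expR.
field; lra.
Qed.

End normal_mgf.

Section freezing.
Local Open Scope ereal_scope.
Context d d1 d2 (T : measurableType d) (X : measurableType d1)
  (U : measurableType d2) (R : realType).
Variables (P : probability T R) (nu : probability U R).
Variables (phi : T -> X) (D : T -> U).
Hypotheses (mphi : measurable_fun setT phi) (mD : measurable_fun setT D).
Hypothesis indep : forall A (B : set U), measurable A -> measurable B ->
  P (phi @^-1` A `&` D @^-1` B) = P (phi @^-1` A) * nu B.

(** By independence the joint law of phi and D is a product measure; Tonelli then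
freezes phi while D is averaged out. *)
Lemma integral_freezing (g : X * U -> \bar R) :
  measurable_fun setT g -> (forall z, 0 <= g z) ->
  \int[P]_w g (phi w, D w) = \int[P]_w \int[nu]_x g (phi w, x).
Proof.
move=> mg g0.
pose phiM : {mfun T >-> X} := HB.pack phi (isMeasurableFun.Build _ _ _ _ _ mphi).
have mpair : measurable_fun setT (fun w => (phi w, D w)) by exact: measurable_fun_pair.
pose pr : {mfun T >-> (X * U)%type} := HB.pack (fun w => (phi w, D w)) (isMeasurableFun.Build _ _ _ _ _ mpair).
transitivity (\int[distribution P pr]_z g z).
  by rewrite ge0_integral_distribution.
transitivity (\int[distribution P phiM \x nu]_z g z).
  apply: eq_measure_integral => A mA _.
  apply/esym/product_measure_unique => // {mA}A B mA mB.
rewrite fubini_tonelli1// /fubini_F ge0_integral_distribution//.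
- have h := (@measurable_fun_fubini_tonelli_F _ _ X U R nu g mg g0). exact: h.
- by move=> y; apply: integral_ge0.
Qed.
End freezing.

Section gaussian_increment.
Local Open Scope ereal_scope.
Context d (T : measurableType d) (R : realType) (P : probability T R).
Variables (G : set (set T)) (n : nat) (D : 'I_n -> T -> R) (s : R).
Hypothesis s0 : (0 < s)%R.
Let U : measurableType _ := measurableTypeR R.
Let nu : probability U R := normal_prob 0 s.
Hypothesis Gm : <<s G >> `<=` measurable.
Hypothesis mD : forall i, measurable_fun setT (D i).
Hypothesis indep : forall (A : set T) (B : 'I_n -> set R),
  <<s G >> A -> (forall i, measurable (B i)) ->
  P (A `&` [set w | forall i, B i (D i w)]) = P A * \prod_(i < n) nu (B i).

(* A pi-system that generates the sigma-algebra of G and D_0, .., D_{j-1}. *)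
Let C (j : nat) : set (set T) := [set E | exists A (B : 'I_n -> set R),
  [/\ <<s G >> A, forall i, measurable (B i) &
      E = A `&` [set w | forall i : 'I_n, (i < j)%N -> B i (D i w)]]].

Let C_setI j : setI_closed (C j).
Proof.
move=> _ _ [A1 [B1 [GA1 mB1 ->]]] [A2 [B2 [GA2 mB2 ->]]].
exists (A1 `&` A2), (fun i => B1 i `&` B2 i); split.
- exact: (@measurableI _ (g_sigma_algebraType G)).
- by move=> i; exact: measurableI.
- apply/seteqP; split=> w /=.
    by move=> [[? h1] [? h2]]; split => // i ij; split; [exact: h1|exact: h2].
  by move=> [[? ?] h]; split; split => // i ij; have [] := h i ij.
Qed.

Let m_cut j (B : 'I_n -> set R) : (forall i, measurable (B i)) ->
  measurable [set w | forall i : 'I_n, (i < j)%N -> B i (D i w)].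
Proof.
move=> mB.
rewrite [X in measurable X](_ : _ =
  \bigcap_(i in [set i : 'I_n | (i < j)%N]) (D i @^-1` B i)) //.
apply: fin_bigcap_measurable => // i _.
by rewrite -[X in measurable X]setTI; exact: mD.
Qed.

Let Cm j : <<s C j >> `<=` measurable.
Proof.
apply: smallest_sub; first exact: sigma_algebra_measurable.
by move=> _ [A [B [/Gm mA mB ->]]]; apply: measurableI => //; exact: m_cut.
Qed.

Let GC j : <<s G >> `<=` <<s C j >>.
Proof.
move=> A GA; apply: sub_sigma_algebra; exists A, (fun=> setT); split => //.
by apply/seteqP; split => // w [].
Qed.

(* Both sides are finite measures in A, so it is enough to compare them on the
   pi-system, where the product formula is applied once with the condition on
   D_j and once without it. *)
Let indep_step (j : 'I_n) (A : set T) (B : set R) : <<s C j >> A -> measurable B ->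
  P (A `&` D j @^-1` B) = P A * nu B.
Proof.
move=> CA mB.
have mDB : measurable (D j @^-1` B) by rewrite -[X in measurable X]setTI; exact: mD.
have nuB : nu B \is a fin_num by exact: fin_num_measure.
pose r : {nonneg R} := NngNum (fine_ge0 (measure_ge0 nu B)).
pose m1 : {measure set T -> \bar R} := mrestr P mDB.
pose m2 : {measure set T -> \bar R} := mscale r P.
have -> : P (A `&` D j @^-1` B) = m1 A by [].
have -> : P A * nu B = m2 A by rewrite /m2/= /mscale/= fineK// muleC.
apply: (@g_sigma_algebra_measure_unique _ R T (C j) _ (fun=> setT)) => //.
- move=> E CE; apply: (@Cm j); exact: sub_sigma_algebra.
- move=> _; exists setT, (fun=> setT); split => //.
  + exact: (@measurableT _ (g_sigma_algebraType G)).
  + by apply/seteqP; split.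
- by rewrite bigcup_const.
- move=> _ [A0 [B0 [GA0 mB0 ->]]].
  rewrite [RHS](_ : _ = P (A0 `&` [set w | forall i : 'I_n, (i < j)%N -> B0 i (D i w)]) * nu B); last first.
    by rewrite /m2/= /mscale/= fineK// muleC.
  rewrite /m1/= /mrestr.
  pose B1 (i : 'I_n) := if (i < j)%N then B0 i else if i == j then B else setT.
  pose B2 (i : 'I_n) := if (i < j)%N then B0 i else setT.
  have mB1 i : measurable (B1 i) by rewrite /B1; case: ifP => // _; case: ifP.
  have mB2 i : measurable (B2 i) by rewrite /B2; case: ifP => // _; case: ifP.
  transitivity (P (A0 `&` [set w | forall i, B1 i (D i w)])).
    congr (P _); apply/seteqP; split => w.
      move=> [[? h] /= ?]; split => // i; rewrite /B1; case: ifPn => ij.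
        exact: h.
      by case: eqP => // ->.
    move=> [? /= h]; split; first split => //= i ij.
      by have := h i; rewrite /B1 ij.
    by have := h j; rewrite /B1 ltnn eqxx.
  rewrite [X in _ = P X * _](_ : _ = A0 `&` [set w | forall i, B2 i (D i w)]); last first.
    apply/seteqP; split => w.
      move=> [? h]; split => // i; rewrite /B2; case: ifPn => ij//.
      exact: h.
    move=> [? /= h]; split => //= i ij.
    by have := h i; rewrite /B2 ij.
  rewrite !indep// (bigD1 j)//= [in RHS](bigD1 j)//= {1}/B1 {1}/B2 ltnn eqxx probability_setT mul1e.
  rewrite -muleA; congr (_ * _); rewrite muleC; congr (_ * _); apply: eq_bigr => i ij.
  by rewrite /B1 /B2 (negbTE ij).
- move=> k; rewrite /m1/= /mrestr; apply: le_lt_trans (ltry 1).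
  by apply: probability_le1; exact: measurableI.
Qed.

Variable v : 'I_n -> T -> R.
Hypothesis mv : forall i, measurable_fun (setT : set (g_sigma_algebraType G)) (v i).

Let e i w : R := (- (v i w * D i w) - 2^-1 * (v i w ^+ 2 * s ^+ 2))%R.

Let finer (j : nat) d' (V : measurableType d') (f : T -> V) :
  measurable_fun (setT : set (g_sigma_algebraType G)) f ->
  measurable_fun (setT : set (g_sigma_algebraType (C j))) f.
Proof. by move=> mf mT E mE; apply: GC; exact: mf. Qed.

Let mgf_step (j : 'I_n) (Y : T -> \bar R) :
  measurable_fun (setT : set (g_sigma_algebraType (C j))) Y -> (forall w, 0 <= Y w) ->
  \int[P]_w (Y w * (expR (e j w))%:E) = \int[P]_w Y w.
Proof.
move=> mY Y0.
pose X : measurableType _ := g_sigma_algebraType (C j).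
pose g (z : X * U) := Y z.1 * (expR (- (v j z.1 * z.2) - 2^-1 * (v j z.1 ^+ 2 * s ^+ 2)))%:E.
have mid : measurable_fun setT (idfun : T -> X).
  by move=> _ E mE; rewrite setTI; exact: (@Cm j E mE).
have mv1 : measurable_fun setT (fun z : X * U => v j z.1).
  by apply: measurableT_comp; [exact: (finer (mv j))|exact: measurable_fst].
have mg : measurable_fun setT g.
  apply: emeasurable_funM.
    by apply: measurableT_comp; [exact: mY|exact: measurable_fst].
  apply/measurable_EFinP; apply: measurableT_comp => //.
  apply: measurable_funB => //.
    apply: measurableT_comp => //; apply: measurable_funM => //; exact: measurable_snd.
  by apply: measurable_funM => //; apply: measurable_funM => //; exact: measurable_funX.
transitivity (\int[P]_w g (idfun w : X, D j w)) => //.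
rewrite (@integral_freezing _ _ _ T X U R P nu (idfun : T -> X) (D j) mid)//.
- apply: eq_integral => w _; rewrite /g/=.
  rewrite ge0_integralZl//; first by rewrite integral_normal_exp// mule1.
  + apply/measurable_EFinP; apply: measurableT_comp => //.
    by apply: measurable_funB => //; apply: measurableT_comp => //.
- exact: mD.
- by move=> A B mA mB; exact: indep_step.
- by move=> z; rewrite /g mule_ge0// lee_fin expR_ge0.
Qed.

Let m_e (j : nat) (i : 'I_n) : (i < j)%N ->
  measurable_fun (setT : set (g_sigma_algebraType (C j))) (e i).
Proof.
move=> ij.
have mDi : measurable_fun (setT : set (g_sigma_algebraType (C j))) (D i).
  move=> _ E mE; rewrite setTI; apply: sub_sigma_algebra.
  exists setT, (fun k => if k == i then E else setT); split.
  + exact: (@measurableT _ (g_sigma_algebraType G)).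
  + by move=> k; case: ifP.
  + apply/seteqP; split => w /=.
      by move=> Ew; split => // k kj; case: eqP => // ->.
    by move=> [_ /(_ i ij)]; rewrite eqxx.
apply: measurable_funB.
  by apply: measurableT_comp => //; apply: measurable_funM => //; exact: finer.
by apply: measurable_funM => //; apply: measurable_funM => //; apply: measurable_funX; exact: finer.
Qed.

(** The components are averaged out one at a time, the last one first: the factors
of smaller index belong to the sigma-algebra that D_j is independent of. *)
Lemma integral_gaussian_exp (Y : T -> \bar R) :
  measurable_fun (setT : set (g_sigma_algebraType G)) Y -> (forall w, 0 <= Y w) ->
  \int[P]_w (Y w * (expR (\sum_(i < n)
    (- (v i w * D i w) - 2^-1 * (v i w ^+ 2 * s ^+ 2))))%:E) = \int[P]_w Y w.
Proof.
move=> mY Y0.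
have H j : (j <= n)%N -> \int[P]_w (Y w * (expR (\sum_(i < n | (i < j)%N) e i w))%:E) = \int[P]_w Y w.
  elim: j => [|j IH] jn.
    by apply: eq_integral => w _; rewrite big_pred0// expR0 mule1.
  rewrite -(IH (ltnW jn)).
  rewrite -(@mgf_step (Ordinal jn) (fun w => Y w * (expR (\sum_(i < n | (i < j)%N) e i w))%:E)).
  - apply: eq_integral => w _; rewrite -muleA -EFinM -expRD; congr (_ * (expR _)%:E).
    rewrite (bigD1 (Ordinal jn)) ?ltnSn//= addrC; congr (_ + _)%R.
    apply: eq_bigl => i; rewrite ltnS -val_eqE/= andbC; exact/esym/ltn_neqAle.
  - apply: emeasurable_funM; first exact: finer.
    apply/measurable_EFinP; apply: measurableT_comp => //.
    under eq_fun do rewrite big_mkcond/=.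
    apply: measurable_sum => i; case: (boolP (i < j)%N) => [ij|_]; last exact: measurable_cst.
    exact: m_e.
  - by move=> w; rewrite mule_ge0// lee_fin expR_ge0.
rewrite -[RHS](H n (leqnn n)); apply: eq_integral => w _.
by congr (_ * (expR _)%:E); apply: eq_bigl => i; rewrite ltn_ord.
Qed.

End gaussian_increment.

(** * The exponential martingale of a simple process *)

Section exponential_martingale.
Context {R : realType} {d : measure_display} {Omega : measurableType d}.
Variables (P : probability Omega R) (T : R) (n : nat) (W : R -> Omega -> 'cV[R]_n).
Hypotheses (cP : measure_is_complete P) (hW : brownian_motion P T W).
Local Notation F := (brownian_filtration P W).
Local Notation Om t := (g_sigma_algebraType (brownian_generators P W t)).

Let mW s i : measurable_fun setT (fun w => W s w i 0).
Proof. by case: hW. Qed.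

Let FT t : F t `<=` measurable.
Proof. exact: brownian_filtration_measurable. Qed.

(** Increment over a time step of the exponent - int v dW - 1/2 int |v|^2. *)
Definition exp_increment (v : 'cV[R]_n) (dW : 'cV[R]_n) (dt : R) : R :=
  - vdot v dW - 2^-1 * (sqnorm v * dt).

Lemma integral_exp_increment (s t : R) (v : Omega -> 'cV[R]_n) (Y : Omega -> \bar R) :
  0 <= s -> s <= t -> t <= T ->
  (forall i, measurable_wrt (F s) (fun w => v w i 0)) ->
  measurable_fun (setT : set (Om s)) Y -> (forall w, 0 <= Y w)%E ->
  (\int[P]_w (Y w * (expR (exp_increment (v w) (W t w - W s w) (t - s)))%:E) =
   \int[P]_w Y w)%E.
Proof.
move=> s0 st tT mv mY Y0.
have [<-|neq_st] := eqVneq s t.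
  apply: eq_integral => w _; rewrite /exp_increment /vdot !subrr mulr0 mulr0 subr0.
  by rewrite big1 ?oppr0 ?expR0 ?mule1// => i _; rewrite mxE mulr0.
have {st neq_st}st : s < t by rewrite lt_neqAle neq_st.
have r0 : 0 < Num.sqrt (t - s) by rewrite sqrtr_gt0 subr_gt0.
rewrite -[RHS](@integral_gaussian_exp _ Omega R P (brownian_generators P W s) n
  (fun i w => W t w i 0 - W s w i 0) _ r0 _ _ _ (fun i w => v w i 0) _ Y mY Y0).
- apply: eq_integral => w _; congr (_ * (expR _)%:E)%E.
  rewrite /exp_increment /sqnorm /vdot mulr_suml mulr_sumr -!sumrN -big_split/=.
  apply: eq_bigr => i _; rewrite !mxE; congr (- _ - _ * _).
  by rewrite sqr_sqrtr ?subr_ge0 ?(ltW st)// expr2.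
- exact: FT.
- by move=> i; exact: measurable_funB.
- by move=> A B FA mB; case: hW => _ _ _; exact.
- by move=> i; apply/measurable_wrtP.
Qed.

(** All the factors are nonnegative, so Tonelli also covers unbounded v_k.  This is
what later allows stopping the approximations instead of truncating them. *)
Lemma integral_simple_exponential (tau : nat -> R) (v : nat -> Omega -> 'cV[R]_n) (N : nat) :
  (forall k, (k <= N)%N -> 0 <= tau k <= T) ->
  (forall k, (k < N)%N -> tau k <= tau k.+1) ->
  (forall k i, (k < N)%N -> measurable_wrt (F (tau k)) (fun w => v k w i 0)) ->
  (\int[P]_w (expR (\sum_(k < N) exp_increment (v k w)
     (W (tau k.+1) w - W (tau k) w) (tau k.+1 - tau k)))%:E = 1)%E.
Proof.
elim: N => [|N IH] htau hle hv.
  under eq_integral do rewrite big_ord0 expR0.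
  by rewrite integral_cst// mul1e; exact: probability_setT.
have tauN k : (k <= N)%N -> tau k <= tau N.
  elim: N {IH hv htau} hle => [|N IH] hle; first by rewrite leqn0 => /eqP ->.
  rewrite leq_eqVlt => /predU1P[->//|]; rewrite ltnS => kN.
  rewrite (le_trans _ (hle N _))//; apply: IH => // j jN; apply: hle.
  exact: (leq_trans jN).
rewrite -[RHS]IH; first last.
- by move=> k i kN; apply: hv; exact: ltnW.
- by move=> k kN; apply: hle; exact: ltnW.
- by move=> k kN; apply: htau; exact: ltnW.
under eq_integral do rewrite big_ord_recr/= expRD EFinM.
have /andP[tN0 _] := htau N (leqnSn N).
have /andP[_ tNT] := htau N.+1 (leqnn _).
apply: (integral_exp_increment (s := tau N)) => //.
- exact: hle.
- by move=> i; exact: hv.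
- apply/measurable_EFinP; apply: measurableT_comp => //.
  apply: measurable_sum => k; have kN := ltn_ord k.
  have mvk i : measurable_fun (setT : set (Om (tau N))) (fun w => v k w i 0).
    apply: (@measurable_wrt_mono _ _ _ _ _ _ (tau k)); first exact/tauN/ltnW.
    by apply: hv; exact: ltnW.
  have mWk j i : (j <= N)%N -> measurable_fun (setT : set (Om (tau N))) (fun w => W (tau j) w i 0).
    move=> jN; apply: measurable_W; have /andP[-> _] := htau j (leqW jN).
    exact: tauN.
  rewrite /exp_increment /sqnorm /vdot; apply: measurable_funB.
    apply: measurableT_comp => //; apply: measurable_sum => i.
    under eq_fun do rewrite !mxE.
    apply: measurable_funM => //; apply: measurable_funB; apply: mWk => //.
    exact: ltnW.
  apply: measurable_funM => //; apply: measurable_funM => //.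
  by apply: measurable_sum => i; exact: measurable_funM.
Qed.

End exponential_martingale.

(** * Passing to the limit in exponential moments *)

Section exponential_limit.
Context {R : realType} {d : measure_display} {Omega : measurableType d}.
Variable P : probability Omega R.

(** The graph of the exponential lies above its tangent at x. *)
Lemma expR_chord (x y : R) : expR x - expR y <= expR x * `|x - y|.
Proof.
have h : expR x * (1 + (y - x)) <= expR y.
  rewrite -[leRHS](_ : expR x * expR (y - x) = _).
    by rewrite ler_pM2l ?expR_gt0// expR_ge1Dx.
  by rewrite -expRD addrC subrK.
have : expR x * (x - y) <= expR x * `|x - y|.
  by rewrite ler_pM2l ?expR_gt0// ler_norm.
lra.
Qed.

(** Almost surely, where U >= 1 or |X - Y| <= U,
exp (min Y N) <= exp X + exp N * U and
exp X <= exp Y + exp N * U + exp (- N) * exp (2 X).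
The first inequality gives E[exp Y] <= 1 and the second one E[exp Y] >= 1, by
letting eps tend to 0 and then N to infinity.  Thus the bound L on the second
moments plays the part of uniform integrability. *)
Lemma integral_exp_limit (Y : Omega -> R) (L : R) :
  measurable_fun setT Y -> 0 <= L ->
  (forall eps, 0 < eps -> exists X U : Omega -> R,
     [/\ measurable_fun setT X, measurable_fun setT U & forall w, 0 <= U w] /\
     [/\ (\int[P]_w (expR (X w))%:E = 1)%E,
         (\int[P]_w (expR (2 * X w))%:E <= L%:E)%E,
         (\int[P]_w (U w)%:E <= eps%:E)%E &
         {ae P, forall w, `|X w - Y w| <= U w \/ 1 <= U w}]) ->
  (\int[P]_w (expR (Y w))%:E = 1)%E.
Proof.
move=> mY L0 HX.
have mexp (f : Omega -> R) : measurable_fun setT f -> measurable_fun setT (fun w => (expR (f w))%:E).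
  by move=> mf; apply/measurable_EFinP; exact: measurableT_comp.
apply/eqP; rewrite eq_le; apply/andP; split.
- have bnd (N : nat) : (\int[P]_w (expR (Num.min (Y w) N%:R))%:E <= 1)%E.
    apply/lee_addgt0Pr => eps eps0.
    have e0 : 0 < eps / expR N%:R by rewrite divr_gt0// expR_gt0.
    have [X [U [[mX mU U0] [X1 _ Ueps aeXU]]]] := HX _ e0.
    apply: (@le_trans _ _ (\int[P]_w ((expR (X w))%:E + (expR N%:R)%:E * (U w)%:E))%E).
      apply: ae_ge0_le_integral => //.
      - apply: mexp; exact: measurable_minr.
      - by move=> w _; rewrite adde_ge0// ?mule_ge0// lee_fin ?expR_ge0.
      - apply: emeasurable_funD; first exact: mexp.
        by apply/measurable_EFinP/measurable_funM.
      apply: filterS aeXU => w XU _; rewrite -EFinM -EFinD lee_fin.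
      have eN := expR_gt0 (N%:R : R).
      have eX := expR_gt0 (X w).
      have lemin : expR (Num.min (Y w) N%:R) <= expR N%:R by rewrite ler_expR ge_min lexx orbT.
      case: XU => [XU|U1]; last first.
        by rewrite (le_trans lemin)// ler_wpDl ?(ltW eX)// ler_peMr// ltW.
      rewrite -lerBlDl; have [YX|XY] := leP (Num.min (Y w) N%:R) (X w).
        by rewrite (@le_trans _ _ 0)// ?subr_le0 ?ler_expR// mulr_ge0// ltW.
      rewrite (le_trans (expR_chord _ _))// ler_pM ?expR_ge0//.
      rewrite (le_trans _ XU)// [leRHS]distrC !ger0_norm ?subr_ge0 ?(ltW XY)//.
        by rewrite lerD2r ge_min lexx.
      by rewrite (le_trans (ltW XY))// ge_min lexx.
    rewrite ge0_integralD//=; first last.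
    - by apply/measurable_EFinP/measurable_funM.
    - by move=> w _; rewrite mule_ge0// lee_fin ?expR_ge0.
    - exact: mexp.
    rewrite X1 leeD2l// ge0_integralZl_EFin//.
    - apply: (@le_trans _ _ ((expR N%:R)%:E * (eps / expR N%:R)%:E)%E).
        by rewrite lee_pmul2l// lte_fin expR_gt0.
      by rewrite -EFinM lee_fin mulrC divfK// gt_eqF// expR_gt0.
    - by move=> w _; rewrite lee_fin.
    - exact/measurable_EFinP.
  have cvg : (\int[P]_w (expR (Num.min (Y w) N%:R))%:E)%E @[N --> \oo] --> (\int[P]_w (expR (Y w))%:E)%E.
    have limE w : limn (fun N => (expR (Num.min (Y w) N%:R))%:E) = (expR (Y w))%:E.
      apply: cvg_lim => //; apply: cvg_near_cst; near=> N.
      congr (expR _)%:E; apply/min_idPl; near: N.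
      exact: nbhs_infty_ger.
    under [X in _ --> X]eq_integral do rewrite -limE.
    apply: (@cvg_monotone_convergence _ _ _ P _ _
      (fun N w => (expR (Num.min (Y w) N%:R))%:E)) => //.
    - move=> N; apply: mexp; exact: measurable_minr.
    - move=> w _ a b ab; rewrite lee_fin ler_expR le_min ge_min lexx/=.
      by rewrite ge_min ler_nat ab orbT.
  rewrite -(cvg_lim _ cvg)//; apply: lime_le; first by apply/cvg_ex; eexists; exact: cvg.
  exact: nearW.
- apply/lee_addgt0Pr => eps eps0.
  pose x := eps / 2 / (L + 1).
  have L1 : 0 < L + 1 by rewrite ltr_wpDl.
  have x0 : 0 < x by rewrite !divr_gt0.
  (* N is chosen so that exp (- N) * L <= eps / 2. *)
  pose N := - ln x.
  have eN : expR N = x^-1 by rewrite expRN lnK.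
  have e0 : 0 < eps / 2 * x by rewrite mulr_gt0// divr_gt0.
  have [X [U [[mX mU U0] [X1 X2 Ueps aeXU]]]] := HX _ e0.
  rewrite -X1.
  apply: (@le_trans _ _ (\int[P]_w ((expR (Y w))%:E + ((x^-1)%:E * (U w)%:E + x%:E * (expR (2 * X w))%:E)))%E).
    apply: ae_ge0_le_integral => //.
    - exact: mexp.
    - move=> w _; rewrite !adde_ge0// ?mule_ge0// lee_fin ?expR_ge0// ?invr_ge0 ltW//.
    - apply: emeasurable_funD; first exact: mexp.
      apply: emeasurable_funD; first by apply/measurable_EFinP/measurable_funM.
      apply: emeasurable_funM => //; apply: mexp; exact: measurable_funM.
    apply: filterS aeXU => w XU _; rewrite -!EFinM -!EFinD lee_fin.
    have eX := expR_gt0 (X w).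
    have eY := expR_gt0 (Y w).
    have xV0 : 0 < x^-1 by rewrite invr_gt0.
    have t1 : 0 <= x^-1 * U w by rewrite mulr_ge0// ltW.
    have t2 : 0 <= x * expR (2 * X w) by rewrite mulr_ge0// ?expR_ge0// ltW.
    have [NX|XN] := ltP N (X w).
      have : expR (X w) <= x * expR (2 * X w).
        rewrite -[x]invrK -eN -expRN -expRD ler_expR; lra.
      lra.
    have XxV : expR (X w) <= x^-1 by rewrite -eN ler_expR.
    case: XU => [XU|U1].
      have h1 := expR_chord (X w) (Y w).
      have : expR (X w) * `|X w - Y w| <= x^-1 * U w.
        by rewrite ler_pM// ltW.
      lra.
    have : x^-1 <= x^-1 * U w by rewrite ler_peMr// ltW.
    lra.
  rewrite ge0_integralD//=; first last.
  - apply: emeasurable_funD; first by apply/measurable_EFinP/measurable_funM.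
    apply: emeasurable_funM => //; apply: mexp; exact: measurable_funM.
  - move=> w _; rewrite !adde_ge0// ?mule_ge0// lee_fin ?expR_ge0// ?invr_ge0 ltW//.
  - exact: mexp.
  rewrite leeD2l// ge0_integralD//=; first last.
  - by apply: emeasurable_funM => //; apply: mexp; exact: measurable_funM.
  - by move=> w _; rewrite ?mule_ge0// lee_fin ?expR_ge0// ltW.
  - by apply/measurable_EFinP/measurable_funM.
  - by move=> w _; rewrite -EFinM lee_fin mulr_ge0// invr_ge0 ltW.
  rewrite ge0_integralZl_EFin//; first last.
  - by rewrite invr_ge0 ltW.
  - exact/measurable_EFinP.
  - by move=> w _; rewrite lee_fin.
  rewrite ge0_integralZl_EFin//; first last.
  - exact: ltW.
  - by apply: mexp; exact: measurable_funM.
  apply: (@le_trans _ _ ((x^-1)%:E * (eps / 2 * x)%:E + x%:E * L%:E)%E).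
    by rewrite leeD// lee_pmul2l// lte_fin ?invr_gt0.
  rewrite -!EFinM -EFinD lee_fin mulrCA mulVf ?gt_eqF// mulr1.
  have : x * L <= eps / 2.
    rewrite /x -mulrA ler_piMr ?divr_ge0 ?(ltW eps0)//.
    by rewrite mulrC ler_pdivrMr// mul1r lerDl.
  lra.
Unshelve. all: by end_near.
Qed.

End exponential_limit.

(** * The market price of risk and the bank account *)

Section linear_algebra.
Context {R : realType} {n : nat}.
Implicit Types (u v x b : 'cV[R]_n) (S : 'M[R]_n).

Lemma vdotE u v : vdot u v = (u^T *m v) 0 0.
Proof. by rewrite mxE; apply: eq_bigr => i _; rewrite mxE. Qed.

Lemma sqnorm_ge0 u : 0 <= sqnorm u.
Proof. by apply: sumr_ge0 => i _; rewrite -expr2 sqr_ge0. Qed.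

Lemma sqnorm_gt0 u : u != 0 -> 0 < sqnorm u.
Proof.
move=> u0; rewrite lt_neqAle sqnorm_ge0 andbT eq_sym; apply: contra u0.
rewrite /sqnorm /vdot psumr_eq0; last by move=> i _; rewrite -expr2 sqr_ge0.
move/allP => h; apply/eqP/colP => i; rewrite mxE.
by have := h i (mem_index_enum i); rewrite /= -expr2 sqrf_eq0 => /eqP.
Qed.

Lemma posdef_sqnorm S (eps : R) x : posdefmx (S *m S^T - eps%:M) ->
  eps * sqnorm x <= sqnorm (S^T *m x).
Proof.
move=> pd; have [->|x0] := eqVneq x 0.
  by rewrite mulmx0 /sqnorm !vdotE !mulmx0 mxE mulr0.
suff E : (x^T *m (S *m S^T - eps%:M) *m x) 0 0 = sqnorm (S^T *m x) - eps * sqnorm x.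
  by have := pd x x0; rewrite E subr_gt0 => /ltW.
rewrite /sqnorm !vdotE trmx_mul trmxK mulmxBr mulmxBl mul_mx_scalar -scalemxAl.
by rewrite !mulmxA [LHS]mxE; congr (_ + _); rewrite !mxE.
Qed.

Lemma posdef_unitmx S (eps : R) : 0 < eps -> posdefmx (S *m S^T - eps%:M) ->
  S \in unitmx.
Proof.
move=> eps0 pd; rewrite -row_free_unit -kermx_eq0; apply/negPn/negP => /rowV0Pn[v].
move=> /sub_kermxP vS v0.
have vT0 : v^T != 0 by apply: contra v0 => /eqP vT; rewrite -[v]trmxK vT trmx0.
have := posdef_sqnorm v^T pd; rewrite -trmx_mul vS trmx0 /sqnorm [leRHS]vdotE mulmx0 mxE.
by rewrite leNgt mulr_gt0// sqnorm_gt0.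
Qed.

(** With y = S^{-1} b and S^T x = y, one has |y|^2 = x . b, while ellipticity gives
eps |x|^2 <= |y|^2; then 2 x . b <= eps |x|^2 + |b|^2 / eps concludes. *)
Lemma posdef_price_bound S b (eps : R) : 0 < eps -> posdefmx (S *m S^T - eps%:M) ->
  sqnorm (invmx S *m b) <= sqnorm b / eps.
Proof.
move=> eps0 pd; have uS := posdef_unitmx eps0 pd.
set y := invmx S *m b.
pose x := invmx S^T *m y.
have Sx : S^T *m x = y by rewrite mulKVmx// unitmx_tr.
have Sy : S *m y = b by rewrite mulKVmx.
have e1 : eps * sqnorm x <= sqnorm y by rewrite -Sx; exact: posdef_sqnorm.
have e2 : sqnorm y = vdot x b.
  by rewrite /sqnorm vdotE -{1}Sx trmx_mul trmxK -mulmxA Sy vdotE.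
have e3 : 2 * vdot x b <= eps * sqnorm x + sqnorm b / eps.
  rewrite /sqnorm /vdot !mulr_sumr mulr_suml -big_split/=; apply: ler_sum => i _.
  rewrite -subr_ge0 (_ : _ - _ = (eps * x i 0 - b i 0) ^+ 2 / eps); last first.
    by field; rewrite gt_eqF.
  by rewrite divr_ge0 ?sqr_ge0// ltW.
lra.
Qed.

End linear_algebra.

Section quadratic_increments.
Context {R : realType}.

(** Cutting [0, t] into N pieces bounds the total increment by C t^2 / N. *)
Lemma cst_of_quadratic_increments (f : R -> R) (t C : R) : 0 <= t -> 0 <= C ->
  (forall a b, 0 <= a -> a <= b -> b <= t -> `|f b - f a| <= C * (b - a) ^+ 2) ->
  f t = f 0.
Proof.
move=> t0 C0 hf.
have bnd (N : nat) : `|f t - f 0| * N.+1%:R <= C * t ^+ 2.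
  pose h : R := t / N.+1%:R.
  have N0 : (0 : R) < N.+1%:R by rewrite ltr0n.
  have h0 : 0 <= h by rewrite divr_ge0// ltW.
  have hN : h * N.+1%:R = t by rewrite /h divfK// gt_eqF.
  have step (k : nat) : (k <= N.+1)%N -> `|f (h * k%:R) - f 0| <= k%:R * (C * h ^+ 2).
    elim: k => [|k IH] kN; first by rewrite mulr0 subrr normr0 mul0r.
    have -> : f (h * k.+1%:R) - f 0 = (f (h * k.+1%:R) - f (h * k%:R)) + (f (h * k%:R) - f 0).
      by rewrite addrA subrK.
    rewrite (le_trans (ler_normD _ _))// -natr1 mulrDl mul1r addrC lerD//.
      exact/IH/ltnW.
    rewrite (le_trans (hf _ _ _ _ _))//.
    - by rewrite mulr_ge0.
    - by rewrite ler_wpM2l// lerDl.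
    - by rewrite natr1 -hN ler_wpM2l// ler_nat.
    - by rewrite ler_wpM2l// mulrDr mulr1 addrAC subrr add0r.
  have := step N.+1 (leqnn _); rewrite hN => le1.
  rewrite -(ler_pM2r N0) in le1; rewrite (le_trans le1)//.
  rewrite /h -hN/= le_eqVlt; apply/orP; left; apply/eqP; rewrite /h hN; field.
  by rewrite gt_eqF.
apply/eqP; rewrite -subr_eq0 -normr_le0; rewrite leNgt; apply/negP => d0.
have := archi_boundP (divr_ge0 (mulr_ge0 C0 (sqr_ge0 t)) (ltW d0)).
set N := Num.bound _ => hN.
have := bnd N; rewrite leNgt => /negP; apply.
rewrite [ltRHS]mulrC -ltr_pdivrMr//; apply: lt_trans hN _.
by rewrite ltr_nat.
Qed.

(** From 1 + x <= exp x applied at x and at - x. *)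
Lemma expR_taylor2 (x M : R) : `|x| <= M -> `|expR x - 1 - x| <= expR M * x ^+ 2.
Proof.
move=> xM; have eM : 1 <= expR M by rewrite -[leLHS](@expR0 R) ler_expR (le_trans _ xM).
have h1 := expR_ge1Dx x.
have h2 : expR x * (1 - x) <= 1.
  rewrite -[leRHS](_ : expR x * expR (- x) = 1); last by rewrite -expRD subrr expR0.
  by rewrite ler_wpM2l ?expR_ge0//; have := expR_ge1Dx (- x).
have exM : expR x <= expR M by rewrite ler_expR (le_trans (ler_norm _)).
rewrite ger0_norm; last by lra.
have [x0|x0] := leP 0 x.
  have : x * (expR x - 1) <= x * (expR x * x) by rewrite ler_wpM2l//; lra.
  have : expR x * x ^+ 2 <= expR M * x ^+ 2 by rewrite ler_wpM2r ?sqr_ge0.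
  by nra.
have : (- x) * (1 - expR x) <= (- x) * (- x) by rewrite ler_wpM2l//; lra.
have : 1 * x ^+ 2 <= expR M * x ^+ 2 by rewrite ler_wpM2r ?sqr_ge0.
by nra.
Qed.

End quadratic_increments.

Section bank_account.
Context {R : realType}.
Local Notation mu := (@lebesgue_measure R).
Variables (T : R) (T0 : 0 <= T).

Lemma normr_Rintegral_le (g : R -> R) (M a b : R) : a <= b ->
  mu.-integrable `]a, b] (EFin \o g) ->
  (forall x, a < x <= b -> `|g x| <= M) ->
  `|\int[mu]_(s in `]a, b]) g s| <= M * (b - a).
Proof.
move=> ab gi gM.
rewrite (le_trans (le_normr_Rintegral _ gi))//.
have muab : mu `]a, b] = (b - a)%:E.
  rewrite lebesgue_measure_itv/= lte_fin; case: ltP => // ba.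
  by rewrite (_ : b = a) ?subrr//; apply/eqP; rewrite eq_le ba ab.
have -> : M * (b - a) = \int[mu]_(s in `]a, b]) M by rewrite Rintegral_cst///= muab.
apply: le_Rintegral => //.
- exact: (integrable_norm gi).
- apply/integrableP; split; first exact: measurable_cst.
  by rewrite integral_cst//= muab -EFinM ltry.
Qed.

Section bounded_functions.
Variables (f : R -> R) (M : R).
Hypothesis mf : measurable_fun (`[0, T]%classic : set (measurableTypeR R)) f.
Hypothesis fM : forall t, 0 <= t <= T -> `|f t| <= M.

Lemma bounded_integrable_itv : mu.-integrable `[0, T] (EFin \o f).
Proof.
apply: measurable_bounded_integrable => //.
  by rewrite /= lebesgue_measure_itv/=; case: ifP; rewrite ?ltry// -EFinB ltry.
exists M; split; first exact: num_real.
move=> x Mx t /=; rewrite in_itv/= => /fM h; exact: le_trans h (ltW Mx).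
Qed.

Lemma bounded_integrable_subitv (a b : R) : 0 <= a -> b <= T ->
  mu.-integrable `]a, b] (EFin \o f).
Proof.
move=> a0 bT; apply: integrableS bounded_integrable_itv => //.
move=> x/=; rewrite !in_itv/= => /andP[ax xb].
by rewrite (le_trans a0 (ltW ax)) (le_trans xb).
Qed.

Lemma Rintegral_increment (a b : R) : 0 <= a -> a <= b -> b <= T ->
  \int[mu]_(s in `[0, b]) f s - \int[mu]_(s in `[0, a]) f s =
  \int[mu]_(s in `]a, b]) f s.
Proof.
move=> a0 ab bT; rewrite Rintegral_itvB//.
apply: integrableS bounded_integrable_itv => //.
by move=> x/=; rewrite !in_itv/= => /andP[-> /le_trans->].
Qed.

End bounded_functions.

Lemma continuous_bounded_itv (S : R -> R) : {within `[0, T], continuous S} ->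
  exists K, forall t, 0 <= t <= T -> `|S t| <= K.
Proof.
move=> cS; have cN : {within `[0, T], continuous (fun t => `|S t|)}.
  by move=> x; apply: continuous_comp; [exact: cS|exact: norm_continuous].
have [x _ h] := EVT_max T0 cN.
by exists `|S x| => t tT; apply: h; rewrite in_itv.
Qed.

(** The rate r is only measurable, so the quotient of S by the exponential of the
integral of r need not be differentiable; its increments are nevertheless
quadratically small, which makes it constant. *)
Lemma bank_accountE (r S : R -> R) (s0 c : R) :
  measurable_fun (`[0, T]%classic : set (measurableTypeR R)) r ->
  (forall t, 0 <= t <= T -> `|r t| <= c) ->
  {within `[0, T], continuous S} ->
  (forall t, 0 <= t <= T -> S t = s0 + \int[mu]_(s in `[0, t]) (r s * S s)) ->
  S T = s0 * expR (\int[mu]_(s in `[0, T]) r s).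
Proof.
move=> mr rc cS SE.
have c0 : 0 <= c by rewrite (le_trans _ (rc 0 _))// lexx.
have [K SK] := continuous_bounded_itv cS.
have K0 : 0 <= K by rewrite (le_trans _ (SK 0 _))// lexx.
have mS : measurable_fun (`[0, T]%classic : set (measurableTypeR R)) S.
  exact: subspace_continuous_measurable_fun.
have mrS : measurable_fun (`[0, T]%classic : set (measurableTypeR R)) (fun s => r s * S s).
  exact: measurable_funM.
have rSK t : 0 <= t <= T -> `|r t * S t| <= c * K.
  by move=> tT; rewrite normrM ler_pM//; [exact: rc|exact: SK].
pose rho t := \int[mu]_(s in `[0, t]) r s.
have rho0 : rho 0 = 0 by rewrite /rho set_itv1 Rintegral_set1.
have S0 : S 0 = s0 by rewrite SE ?lexx// set_itv1 Rintegral_set1 addr0.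
have dS a b : 0 <= a -> a <= b -> b <= T -> S b - S a = \int[mu]_(s in `]a, b]) (r s * S s).
  move=> a0 ab bT; rewrite -(Rintegral_increment mrS rSK a0 ab bT) SE ?(le_trans a0)//.
  by rewrite SE ?a0 ?(le_trans ab)//; ring.
have dSK a b : 0 <= a -> a <= b -> b <= T -> `|S b - S a| <= c * K * (b - a).
  move=> a0 ab bT; rewrite dS//; apply: normr_Rintegral_le => //.
    exact: (bounded_integrable_subitv mrS rSK).
  by move=> x /andP[ax xb]; apply: rSK; rewrite (le_trans a0 (ltW ax)) (le_trans xb).
have drho a b : 0 <= a -> a <= b -> b <= T -> `|rho b - rho a| <= c * (b - a).
  move=> a0 ab bT; rewrite /rho (Rintegral_increment mr rc)//.
  apply: normr_Rintegral_le => //; first exact: (bounded_integrable_subitv mr rc).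
  by move=> x /andP[ax xb]; apply: rc; rewrite (le_trans a0 (ltW ax)) (le_trans xb).
pose E := expR (c * T).
have E0 : 0 < E := expR_gt0 _.
suff H : S T * expR (- rho T) = S 0 * expR (- rho 0).
  rewrite rho0 oppr0 expR0 mulr1 S0 in H.
  by rewrite -H -mulrA -expRD addNr expR0 mulr1.
pose C := E * (c ^+ 2 * K + K * (E * c ^+ 2)).
apply: (@cst_of_quadratic_increments _ (fun t => S t * expR (- rho t)) T C) => //.
  by rewrite /C; have := ltW E0 => E0'; do ?[apply: mulr_ge0|apply: addr_ge0|exact: sqr_ge0|exact: E0'|exact: K0].
move=> a b a0 ab bT.
have aT := le_trans ab bT.
set h := b - a; have h0 : 0 <= h by rewrite subr_ge0.
set dl := rho b - rho a.
have dlh : `|dl| <= c * h by exact: drho.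
have hT : h <= T by rewrite /h; lra.
have dlT : `|dl| <= c * T by rewrite (le_trans dlh)// ler_wpM2l.
have rhoT : `|rho b| <= c * T.
  have := drho 0 b (lexx _) (le_trans a0 ab) bT; rewrite rho0 !subr0 => /le_trans; apply.
  by rewrite ler_wpM2l.
have eT : expR (- rho b) <= E by rewrite ler_expR (le_trans (ler_norm _))// normrN.
have -> : S b * expR (- rho b) - S a * expR (- rho a) =
    expR (- rho b) * ((S b - S a - S a * dl) - S a * (expR dl - 1 - dl)).
  have -> : expR (- rho a) = expR (- rho b) * expR dl by rewrite -expRD /dl; congr expR; ring.
  ring.
have i1 := bounded_integrable_subitv mrS rSK a0 bT.
have i2 := bounded_integrable_subitv mr rc a0 bT.
have i3 : mu.-integrable `]a, b] (EFin \o (fun s => S a * r s)).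
  apply: (bounded_integrable_subitv (M := K * c)) => //; first exact: measurable_funM.
  by move=> t tT; rewrite normrM ler_pM// ?SK ?rc// a0.
rewrite normrM (ger0_norm (expR_ge0 _)) /C -mulrA; apply: ler_pM => //.
rewrite (le_trans (ler_normB _ _))// mulrDl lerD//.
- have -> : S b - S a - S a * dl = \int[mu]_(s in `]a, b]) (r s * S s - S a * r s).
    rewrite RintegralB//.
    by rewrite RintegralZl// -dS// /dl /rho (Rintegral_increment mr rc).
  rewrite (_ : _ * h ^+ 2 = (c * (c * K * h)) * h); last ring.
  apply: normr_Rintegral_le => //.
    exact: (integrableB _ i1 i3).
  move=> x /andP[ax xb].
  rewrite (_ : _ - _ = r x * (S x - S a)); last ring.
  rewrite normrM; apply: ler_pM => //.
    by apply: rc; rewrite (le_trans a0 (ltW ax)) (le_trans xb).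
  rewrite (le_trans (dSK _ _ a0 (ltW ax) (le_trans xb bT)))//.
  by rewrite ler_wpM2l ?mulr_ge0// /h lerD2r.
- rewrite normrM -mulrA; apply: ler_pM => //; first by apply: SK; rewrite a0.
  rewrite (le_trans (expR_taylor2 dlT))// -mulrA ler_wpM2l ?(ltW E0)//.
  by rewrite -exprMn -[leLHS]real_normK ?num_real// ler_sqr ?nnegrE ?mulr_ge0.
Qed.

End bank_account.

(** * The exponential of an Ito integral *)

Section sqnorm_inequalities.
Context {R : realType} {n : nat}.
Implicit Types a b : 'cV[R]_n.

Lemma vdotZl (k : R) a b : vdot (k *: a) b = k * vdot a b.
Proof. by rewrite /vdot mulr_sumr; apply: eq_bigr => i _; rewrite mxE mulrA. Qed.

Lemma sqnormZ (k : R) a : sqnorm (k *: a) = k ^+ 2 * sqnorm a.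
Proof. by rewrite /sqnorm /vdot mulr_sumr; apply: eq_bigr => i _; rewrite mxE; ring. Qed.

Lemma sqnorm_diff_le a b (e : R) : 0 < e ->
  `|sqnorm a - sqnorm b| <= (1 + e^-1) * sqnorm (a - b) + e * sqnorm b.
Proof.
move=> e0; rewrite /sqnorm /vdot !mulr_sumr -sumrB -big_split/=.
rewrite (le_trans (ler_norm_sum _ _ _))//; apply: ler_sum => i _; rewrite !mxE.
set x := a i 0; set y := b i 0.
rewrite ler_norml; apply/andP; split; rewrite -subr_ge0.
- rewrite (_ : _ - _ = 2 * (x - y) ^+ 2 + (x - y + e * y) ^+ 2 / e).
    by rewrite addr_ge0// mulr_ge0 ?sqr_ge0 ?invr_ge0 ?(ltW e0).
  by field; rewrite gt_eqF.
- rewrite (_ : _ - _ = (x - y - e * y) ^+ 2 / e).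
    by rewrite mulr_ge0 ?sqr_ge0// invr_ge0 ltW.
  by field; rewrite gt_eqF.
Qed.

Lemma sqnorm_le2 a b : sqnorm a <= 2 * sqnorm (a - b) + 2 * sqnorm b.
Proof.
rewrite /sqnorm /vdot !mulr_sumr -big_split/=.
apply: ler_sum => i _; rewrite !mxE -subr_ge0.
rewrite (_ : _ - _ = (a i 0 - 2 * b i 0) ^+ 2); last by ring.
exact: sqr_ge0.
Qed.

End sqnorm_inequalities.

Lemma nondecreasing_upto {R : realType} (tau : nat -> R) (N : nat) :
  (forall k, (k < N)%N -> tau k <= tau k.+1) ->
  forall j k, (j <= k)%N -> (k <= N)%N -> tau j <= tau k.
Proof.
move=> htau j k; elim: k => [|k IH]; first by rewrite leqn0 => /eqP ->.
rewrite leq_eqVlt => /predU1P[->//|]; rewrite ltnS => jk kN.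
by rewrite (le_trans (IH jk (ltnW kN)))// htau.
Qed.

(** The terms that are kept form an initial segment, whose sum is a partial sum
that has not exceeded C. *)
Lemma stopped_sum_le {R : realType} (a : nat -> R) (C : R) (N : nat) :
  (forall k, 0 <= a k) -> 0 <= C ->
  \sum_(k < N) (if \sum_(j < k.+1) a j <= C then a k else 0) <= C.
Proof.
move=> a0 C0.
(* The bound by the full sum is needed for the induction to go through. *)
suff : \sum_(k < N) (if \sum_(j < k.+1) a j <= C then a k else 0) <= Num.min C (\sum_(k < N) a k).
  by rewrite le_min => /andP[].
elim: N => [|N IH]; first by rewrite !big_ord0 le_min C0 lexx.
rewrite [X in Num.min _ X]big_ord_recr [leLHS]big_ord_recr/=.
move: IH; rewrite !le_min => /andP[h1 h2].
case: ifPn => [h|_]; first by rewrite lerD2r h2 (le_trans _ h)// big_ord_recr/= lerD2r.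
by rewrite addr0 h1/= (le_trans h2)// lerDl.
Qed.

Section simple_processes.
Context {R : realType} {d : measure_display} {Omega : measurableType d}.
Variables (n : nat) (T : R) (h : simple_process (R := R) (Omega := Omega) n).
Local Notation N := (sp_size h).
Local Notation tau := (sp_time h).
Hypotheses (htau : forall k, (k <= N)%N -> 0 <= tau k <= T)
  (hle : forall k, (k < N)%N -> tau k <= tau k.+1).

(** The intervals ]tau k, tau k.+1] are disjoint: the cross terms vanish. *)
Lemma sqnorm_simple_path s w : sqnorm (simple_path h s w) =
  \sum_(k < N) (\1_(`]tau k, tau k.+1]%classic) s : R) * sqnorm (sp_val h k w).
Proof.
have ind (k : nat) : (\1_(`]tau k, tau k.+1]%classic) s : R) = ((tau k < s <= tau k.+1)%R : bool)%:R.
  by rewrite indicE mem_setE in_itv.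
rewrite /simple_path; under eq_bigr do rewrite ind; under [RHS]eq_bigr do rewrite ind.
case: (pickP (fun k : 'I_N => tau k < s <= tau k.+1)) => [k /[dup] ks /andP[ks1 ks2]|none].
  have other (j : 'I_N) : j != k -> (tau j < s <= tau j.+1) = false.
    rewrite neq_ltn => /orP[jk|kj]; apply/negbTE; rewrite negb_and -leNgt -ltNge.
      by rewrite (le_lt_trans _ ks1) ?orbT// (nondecreasing_upto hle)// ltnW.
    by rewrite (le_trans ks2)// (nondecreasing_upto hle)// ltnW.
  rewrite (bigD1 k)//= ks scale1r big1 ?addr0; last by move=> j /other ->; rewrite scale0r.
  by rewrite (bigD1 k)//= ks mul1r big1 ?addr0// => j /other ->; rewrite mul0r.
rewrite big1 => [|k _]; last by rewrite none scale0r.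
by rewrite big1 => [|k _]; rewrite ?none ?mul0r// /sqnorm vdotE mulmx0 mxE.
Qed.

Lemma integral_sqnorm_simple_path w :
  (\int[lebesgue_measure]_(s in `[0%R, T]) (sqnorm (simple_path h s w))%:E =
   (\sum_(k < N) (tau k.+1 - tau k) * sqnorm (sp_val h k w))%:E)%E.
Proof.
under eq_integral do rewrite sqnorm_simple_path -sumEFin.
rewrite ge0_integral_sum//.
- rewrite -sumEFin; apply: eq_bigr => k _.
  under eq_integral do rewrite mulrC EFinM.
  rewrite ge0_integralZl_EFin ?sqnorm_ge0//.
  + rewrite integral_indic// mulrC EFinM; congr (_ * _)%E.
    rewrite setIidl; last first.
      move=> s/=; rewrite !in_itv/= => /andP[s1 s2].
      have /andP[t1 _] := htau (ltnW (ltn_ord k)).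
      have /andP[_ t2] := htau (ltn_ord k).
      by rewrite (le_trans t1 (ltW s1)) (le_trans s2).
    rewrite /= lebesgue_measure_itv/= lte_fin EFinB; case: ltP => // tt.
    have -> : tau k.+1 = tau k by apply/eqP; rewrite eq_le tt hle.
    by rewrite -EFinB subrr.
  + by apply/measurable_EFinP.
- move=> k; apply/measurable_EFinP; apply: measurable_funM => //.
- by move=> k s _; rewrite lee_fin mulr_ge0 ?sqnorm_ge0.
Qed.

End simple_processes.

Section ito_exponential.
Context {R : realType} {d : measure_display} {Omega : measurableType d}.
Variables (P : probability Omega R) (T : R) (n : nat) (W : R -> Omega -> 'cV[R]_n).
Hypotheses (T0 : 0 <= T) (cP : measure_is_complete P) (hW : brownian_motion P T W).
Local Notation F := (brownian_filtration P W).
Local Notation leb := (@lebesgue_measure R).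
Let U : measurableType _ := measurableTypeR R.
Local Notation strip := (`[0, T]%classic `*` setT : set (U * Omega)).

Let FT t : F t `<=` measurable.
Proof. by apply: brownian_filtration_measurable => //; case: hW. Qed.

Let measurable_wrtW t (f : Omega -> R) : measurable_wrt (F t) f -> measurable_fun setT f.
Proof. by move=> mf _ B mB; rewrite setTI; apply: FT (mf B mB). Qed.

Lemma measurable_sqnorm_strip (f : U * Omega -> 'cV[R]_n) :
  (forall i, measurable_fun strip (fun z => f z i 0)) ->
  measurable_fun strip (fun z => sqnorm (f z)).
Proof.
by move=> mf; apply: measurable_sum => i; apply: measurable_funM.
Qed.

Lemma progressive_strip (X : R -> Omega -> R) : progressive F T X ->
  measurable_fun strip (fun z => X z.1 z.2).
Proof. by move=> pX; apply: (@strip_measurable _ _ _ P T n W _ (@FT T)); exact: progressive_measurable. Qed.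

Lemma simple_path_strip (h : simple_process n) i : simple_adapted T F h ->
  measurable_fun strip (fun z => simple_path h z.1 z.2 i 0).
Proof.
case=> htau hle hv _.
rewrite [X in measurable_fun _ X](_ : _ = fun z => \sum_(k < sp_size h)
    (\1_(`]sp_time h k, sp_time h k.+1]%classic) z.1 : R) * sp_val h k z.2 i 0); last first.
  by apply/funext => z; rewrite /simple_path summxE; apply: eq_bigr => k _; rewrite mxE.
apply: measurable_sum => k.
apply: measurable_funM; apply: measurable_funTS.
- apply: (measurableT_comp (f := \1_(`]sp_time h k, sp_time h k.+1]%classic) : U -> R)).
    exact: measurable_indic.
  exact: measurable_fst.
- apply: (measurableT_comp (f := fun w : Omega => sp_val h k w i 0)).
    exact: measurable_wrtW (hv k i (ltn_ord k)).
  exact: measurable_snd.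
Qed.

Section stopped_process.
Variables (h : simple_process (R := R) (Omega := Omega) n) (C : R).
Hypotheses (ah : simple_adapted T F h) (C0 : 0 <= C).
Local Notation N := (sp_size h).
Local Notation tau := (sp_time h).

Definition simple_energy (m : nat) (w : Omega) : R :=
  \sum_(k < m) (tau k.+1 - tau k) * sqnorm (sp_val h k w).

(** The energy up to time tau k.+1 is known at time tau k, so that stopping on it
preserves adaptedness. *)
Definition stopped_val (k : nat) (w : Omega) : 'cV[R]_n :=
  if simple_energy k.+1 w <= C then sp_val h k w else 0.

Definition stopped_exponent (w : Omega) : R :=
  \sum_(k < N) exp_increment (stopped_val k w)
     (W (tau k.+1) w - W (tau k) w) (tau k.+1 - tau k).

Let htau := let: And4 a _ _ _ := ah in a.
Let hle := let: And4 _ a _ _ := ah in a.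
Let hval := let: And4 _ _ a _ := ah in a.

Lemma stopped_val_adapted k i : (k < N)%N ->
  measurable_wrt (F (tau k)) (fun w => stopped_val k w i 0).
Proof.
move=> kN; apply/measurable_wrtP.
have mval j i' : (j <= k)%N -> measurable_fun (setT : set (g_sigma_algebraType (brownian_generators P W (tau k))))
    (fun w => sp_val h j w i' 0).
  move=> jk; apply: (@measurable_wrt_mono _ _ _ _ _ _ (tau j)).
    by apply: (nondecreasing_upto hle) => //; exact: ltnW.
  by apply: hval; exact: leq_ltn_trans kN.
rewrite (_ : (fun w => stopped_val k w i 0) = (fun w =>
   if simple_energy k.+1 w <= C then sp_val h k w i 0 else 0)); last first.
  by apply/funext => w; rewrite /stopped_val; case: ifP => // _; rewrite mxE.
apply: measurable_fun_ifT => //; last exact: mval.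
apply: measurable_fun_ler => //.
apply: measurable_sum => j; apply: measurable_funM => //.
by apply: measurable_sum => i'; apply: measurable_funM; apply: mval; rewrite -ltnS.
Qed.

Lemma integral_stopped_exponential : (\int[P]_w (expR (stopped_exponent w))%:E = 1)%E.
Proof. by apply: (integral_simple_exponential cP hW) => //; exact: stopped_val_adapted. Qed.

Let measurable_exp_increments (v : nat -> Omega -> 'cV[R]_n) :
  (forall k i, (k < N)%N -> measurable_fun setT (fun w => v k w i 0)) ->
  measurable_fun setT (fun w => \sum_(k < N) exp_increment (v k w)
     (W (tau k.+1) w - W (tau k) w) (tau k.+1 - tau k)).
Proof.
move=> mv'; have mW s i : measurable_fun setT (fun w => W s w i 0) by case: hW.
apply: measurable_sum => k; have mv i := mv' k i (ltn_ord k).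
rewrite /exp_increment /sqnorm /vdot; apply: measurable_funB.
  apply: measurableT_comp => //; apply: measurable_sum => i.
  under eq_fun do rewrite !mxE.
  by apply: measurable_funM => //; apply: measurable_funB.
apply: measurable_funM => //; apply: measurable_funM => //.
by apply: measurable_sum => i; exact: measurable_funM.
Qed.

Lemma measurable_stopped_exponent : measurable_fun setT stopped_exponent.
Proof.
by apply: measurable_exp_increments => k i kN; exact: measurable_wrtW (stopped_val_adapted i kN).
Qed.

Lemma stopped_energy_le w :
  \sum_(k < N) (tau k.+1 - tau k) * sqnorm (stopped_val k w) <= C.
Proof.
pose a (k : nat) := if (k < N)%N then (tau k.+1 - tau k) * sqnorm (sp_val h k w) else 0.
have a0 k : 0 <= a k.
  by rewrite /a; case: ifP => // kN; rewrite mulr_ge0 ?sqnorm_ge0 ?subr_ge0 ?hle.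
have := stopped_sum_le N a0 C0.
congr (_ <= _); apply: eq_bigr => k _.
have -> : \sum_(j < k.+1) a j = simple_energy k.+1 w.
  apply: eq_bigr => j _; rewrite /a ifT//.
  by rewrite (leq_trans (ltn_ord j))// ltn_ord.
rewrite /stopped_val /a ltn_ord; case: ifP => // _.
by rewrite /sqnorm vdotE mulmx0 mxE mulr0.
Qed.

(** Twice the exponent of v is the exponent of 2 v plus the energy of v, which is at
most C after stopping. *)
Lemma integral_stopped_exponential_sq :
  (\int[P]_w (expR (2 * stopped_exponent w))%:E <= (expR C)%:E)%E.
Proof.
pose v2 (k : nat) w := 2 *: stopped_val k w.
have X2 : (\int[P]_w (expR (\sum_(k < N) exp_increment (v2 k w)
     (W (tau k.+1) w - W (tau k) w) (tau k.+1 - tau k)))%:E = 1)%E.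
  apply: (integral_simple_exponential cP hW) => // k i kN.
  apply/measurable_wrtP; rewrite /v2; under eq_fun do rewrite mxE.
  by apply: measurable_funM => //; apply/measurable_wrtP; exact: stopped_val_adapted.
have mv2 : measurable_fun setT (fun w => \sum_(k < N) exp_increment (v2 k w)
     (W (tau k.+1) w - W (tau k) w) (tau k.+1 - tau k)).
  apply: measurable_exp_increments => k i kN; rewrite /v2; under eq_fun do rewrite mxE.
  by apply: measurable_funM => //; exact: measurable_wrtW (stopped_val_adapted i kN).
rewrite -[leRHS]mule1 -X2 -ge0_integralZl_EFin ?expR_ge0//; last first.
  by apply/measurable_EFinP; exact: measurableT_comp.
apply: ge0_le_integral => //.
- apply/measurable_EFinP; apply: measurableT_comp => //; apply: measurable_funM => //.
  exact: measurable_stopped_exponent.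
- by apply/measurable_EFinP; apply: measurable_funM => //; exact: measurableT_comp.
move=> w _; rewrite -EFinM lee_fin -expRD ler_expR -lerBlDr.
apply: le_trans (stopped_energy_le w); rewrite /stopped_exponent mulr_sumr -sumrB.
apply: ler_sum => k _; rewrite /exp_increment /v2 sqnormZ vdotZl.
by rewrite le_eqVlt; apply/orP; left; apply/eqP; field.
Qed.

Lemma stopped_exponentE w : simple_energy N w <= C ->
  stopped_exponent w = - simple_integral W h T w - 2^-1 * simple_energy N w.
Proof.
move=> eC; rewrite /simple_integral /simple_energy mulr_sumr -sumrN -sumrB.
apply: eq_bigr => k _; have kN := ltn_ord k.
have -> : stopped_val k w = sp_val h k w.
  rewrite /stopped_val ifT//; apply: le_trans eC.
  rewrite /simple_energy -!(big_mkord xpredT (fun k => (tau k.+1 - tau k) * sqnorm (sp_val h k w))).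
  rewrite [leRHS](big_cat_nat (n := k.+1))//= lerDl big_nat_cond.
  apply: sumr_ge0 => j /andP[/andP[_ jN] _].
  by rewrite mulr_ge0 ?sqnorm_ge0 ?subr_ge0 ?hle.
have /andP[_ t1] := htau (ltnW kN); have /andP[_ t2] := htau kN.
by rewrite /exp_increment (min_idPl t1) (min_idPl t2) [_ * (_ - _)]mulrC.
Qed.

End stopped_process.


Section pathwise.
Variables (phi : R -> 'cV[R]_n) (c : R) (h : simple_process (R := R) (Omega := Omega) n).
Variable w : Omega.
Hypothesis ah : simple_adapted T F h.
Hypothesis mphi : measurable_fun (`[0, T]%classic : set U) (fun s => sqnorm (phi s)).
Hypothesis mdiff : measurable_fun (`[0, T]%classic : set U)
  (fun s => sqnorm (simple_path h s w - phi s)).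
Hypothesis phic : forall s, 0 <= s <= T -> sqnorm (phi s) <= c.

Let q : R := \int[leb]_(s in `[0, T]) sqnorm (phi s).
Let D : R := \int[leb]_(s in `[0, T]) sqnorm (simple_path h s w - phi s).
Let e : R := simple_energy h (sp_size h) w.

Let mpath : measurable_fun (`[0, T]%classic : set U) (fun s => sqnorm (simple_path h s w)).
Proof.
case: ah => htau hle _ _.
rewrite (_ : (fun s => _) = fun s : U => \sum_(k < sp_size h)
  (\1_(`]sp_time h k, sp_time h k.+1]%classic) s : R) * sqnorm (sp_val h k w)).
  2: by apply/funext => s; rewrite sqnorm_simple_path.
by apply: measurable_sum => k; apply: measurable_funM => //; exact: measurable_funTS.
Qed.

Let ipath : leb.-integrable `[0, T] (EFin \o (fun s => sqnorm (simple_path h s w))).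
Proof.
case: ah => htau hle _ _.
apply/integrableP; split; first exact/measurable_EFinP.
under eq_integral do rewrite /= ger0_norm ?sqnorm_ge0//.
by rewrite integral_sqnorm_simple_path// ltry.
Qed.

Let iphi : leb.-integrable `[0, T] (EFin \o (fun s => sqnorm (phi s))).
Proof.
apply: (bounded_integrable_itv (M := c)) => // t tT.
by rewrite ger0_norm ?sqnorm_ge0// phic.
Qed.

Let eE : e = \int[leb]_(s in `[0, T]) sqnorm (simple_path h s w).
Proof. by case: ah => htau hle _ _; rewrite /Rintegral integral_sqnorm_simple_path. Qed.

Lemma integrable_sqnorm_diff :
  leb.-integrable `[0, T] (EFin \o (fun s => sqnorm (simple_path h s w - phi s))).
Proof.
have i2 : leb.-integrable `[0, T] (EFin \o (fun s =>
    2 * sqnorm (simple_path h s w) + 2 * sqnorm (phi s))).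
  rewrite (_ : _ \o _ = (fun s => 2%:E * (sqnorm (simple_path h s w))%:E +
      2%:E * (sqnorm (phi s))%:E)%E)//.
  by apply: integrableD => //; exact: integrableZl.
apply: le_integrable i2 => //; first exact/measurable_EFinP.
move=> s _ /=; rewrite lee_fin !ger0_norm ?addr_ge0 ?mulr_ge0 ?sqnorm_ge0//.
have := sqnorm_le2 (simple_path h s w - phi s) (- phi s).
by rewrite opprK subrK -scaleN1r sqnormZ sqrrN expr1n mul1r.
Qed.

Lemma energy_limit_le : q <= c * T.
Proof.
have lebT : leb `[0, T] = T%:E.
  rewrite lebesgue_measure_itv/= lte_fin; case: ltP => [_|Tle0].
    by rewrite -EFinB subr0.
  by rewrite (_ : T = 0)//; apply/eqP; rewrite eq_le Tle0 T0.
have -> : c * T = \int[leb]_(s in `[0, T]) c by rewrite Rintegral_cst//= lebT.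
apply: le_Rintegral => //.
by apply: (bounded_integrable_itv (M := `|c|)) => //; exact: measurable_cst.
Qed.

(** Comparing energies through the weighted inequality [sqnorm_diff_le] replaces
Cauchy-Schwarz; the weight dl is a free small parameter. *)
Lemma energy_diff_le (dl : R) : 0 < dl -> `|e - q| <= (1 + dl^-1) * D + dl * (c * T).
Proof.
move=> dl0; have iD := integrable_sqnorm_diff.
have i1 : leb.-integrable `[0, T] (EFin \o (fun s => (1 + dl^-1) * sqnorm (simple_path h s w - phi s))).
  by apply: (integrableZl _ (1 + dl^-1) iD).
have i2 : leb.-integrable `[0, T] (EFin \o (fun s => dl * sqnorm (phi s))).
  by apply: (integrableZl _ dl iphi).
have qc := energy_limit_le.
rewrite (@le_trans _ _ ((1 + dl^-1) * D + dl * q))//; last first.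
  by rewrite lerD2l ler_pM2l.
rewrite eE /q -RintegralB//.
have i3 : leb.-integrable `[0, T] (EFin \o (fun s => sqnorm (simple_path h s w) - sqnorm (phi s))).
  by exact: (integrableB _ ipath iphi).
rewrite (le_trans (le_normr_Rintegral _ i3))//.
rewrite /D -!RintegralZl// -RintegralD//.
apply: le_Rintegral => //.
- exact: (integrable_norm i3).
- exact: (integrableD _ i1 i2).
- by move=> s _; exact: sqnorm_diff_le.
Qed.

Lemma energy_le : e <= 2 * D + 2 * (c * T).
Proof.
have := energy_diff_le ltr01; rewrite invr1 mul1r => /ler_normlP[_].
have := energy_limit_le; lra.
Qed.

End pathwise.

Let cvg0_le (u : nat -> \bar R) (eps : R) : u m @[m --> \oo] --> 0%E -> 0 < eps ->
  \forall m \near \oo, (u m <= eps%:E)%E.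
Proof.
move=> /fine_cvgP[ufin /cvgr0_norm_le u0] eps0.
near=> m; have um : u m \is a fin_num by near: m.
rewrite -(fineK um) lee_fin (le_trans (ler_norm _))//; near: m; exact: u0.
Unshelve. all: by end_near. Qed.

(** The stopping level is above twice the energy c T of phi, with a margin of 2:
where the approximation is stopped, its squared distance to phi is at least 1,
so that the error variable exceeds 1 as [integral_exp_limit] requires.
Elsewhere the exponents differ by the errors on the stochastic integral and on
the energy. *)
Theorem integral_ito_exponential (phi : R -> Omega -> 'cV[R]_n) (I : Omega -> R) (c : R) :
  0 <= c -> ito_integral P T W phi T I ->
  {ae P, forall w, forall s, 0 <= s <= T -> sqnorm (phi s w) <= c} ->
  (\int[P]_w (expR (- I w -
     2^-1 * \int[leb]_(s in `[0, T]) sqnorm (phi s w)))%:E = 1)%E.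
Proof.
move=> c0 [pphi mI [h [ah hD hI]]] phic.
pose q w := \int[leb]_(s in `[0, T]) sqnorm (phi s w).
pose D m w := \int[leb]_(s in `[0, T]) sqnorm (simple_path (h m) s w - phi s w).
have mphi : measurable_fun strip (fun z => sqnorm (phi z.1 z.2)).
  by apply: measurable_sqnorm_strip => i; exact: (progressive_strip (pphi i)).
have mdiff m : measurable_fun strip (fun z => sqnorm (simple_path (h m) z.1 z.2 - phi z.1 z.2)).
  apply: measurable_sqnorm_strip => i.
  rewrite [X in measurable_fun _ X](_ : _ = (fun z => simple_path (h m) z.1 z.2 i 0) \-
      (fun z => phi z.1 z.2 i 0)); last by apply/funext => z; rewrite !mxE.
  by apply: measurable_funB; [exact: simple_path_strip|exact: (progressive_strip (pphi i))].
have mphis w := measurable_section_itv w mphi.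
have mdiffs m w := measurable_section_itv w (mdiff m).
have mq : measurable_fun setT q := measurable_Rintegral_itv mphi.
have mD m : measurable_fun setT (D m) := measurable_Rintegral_itv (mdiff m).
have mI' : measurable_fun setT I := measurable_wrtW mI.
have D0 m w : 0 <= D m w by apply: Rintegral_ge0 => s _; exact: sqnorm_ge0.
have ED m : (\int[P]_w (D m w)%:E = \int[P]_w \int[leb]_(s in `[0%R, T])
    (sqnorm (simple_path (h m) s w - phi s w))%:E)%E.
  apply: ge0_ae_eq_integral => //.
  - exact/measurable_EFinP.
  - apply: (@measurable_integral_itv _ Omega R T
      (fun z => (sqnorm (simple_path (h m) z.1 z.2 - phi z.1 z.2))%:E)).
      by apply/measurable_EFinP; exact: mdiff.
    by move=> z _; rewrite lee_fin sqnorm_ge0.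
  - by move=> w _; rewrite lee_fin.
  - by move=> w _; apply: integral_ge0 => s _; rewrite lee_fin sqnorm_ge0.
  apply: filterS phic => w phicw _.
  rewrite /D /Rintegral fineK//.
  exact: (integrable_fin_num _ (integrable_sqnorm_diff (ah m) (mphis w) (mdiffs m w) phicw)).
pose C := 2 * (c * T) + 2.
have cT0 : 0 <= c * T by rewrite mulr_ge0.
have C0 : 0 <= C by rewrite /C; lra.
apply: (@integral_exp_limit _ _ _ P _ (expR C)).
- by apply: measurable_funB; [exact: measurableT_comp|exact: measurable_funM].
- exact: expR_ge0.
move=> eps eps0.
(* dl makes the constant part of the error at most eps / 2; eta, then m, do the
   same for the two random parts. *)
pose dl := Num.min 1 (eps / (1 + c * T)).
have cT1 : 0 < 1 + c * T by rewrite ltr_pwDl.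
have dl0 : 0 < dl by rewrite lt_min ltr01 divr_gt0.
have dl1 : dl <= 1 by rewrite ge_min lexx.
have dle : dl * (1 + c * T) <= eps by rewrite -ler_pdivlMr// ge_min lexx orbT.
have dlV : 1 <= dl^-1 by rewrite -[leLHS]invr1 lef_pV2 ?posrE.
pose eta := eps / 2 / (2^-1 + dl^-1).
have k0 : 0 < 2^-1 + dl^-1 by lra.
have eta0 : 0 < eta by rewrite !divr_gt0.
have [m [hDm hIm]] : exists m, (\int[P]_w (D m w)%:E <= eta%:E)%E /\
    (\int[P]_w ((simple_integral W (h m) T w - I w) ^+ 2)%:E <= eta%:E)%E.
  near \oo => m; exists m; split; last by near: m; exact: (cvg0_le hI).
  by rewrite ED; near: m; exact: (cvg0_le hD).
pose J w := (simple_integral W (h m) T w - I w) ^+ 2.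
have mJ : measurable_fun setT J.
  apply: measurable_funX; apply: measurable_funB => //.
  rewrite /simple_integral /vdot; apply: measurable_sum => k; apply: measurable_sum => i.
  have [_ _ hv _] := ah m.
  under eq_fun do rewrite !mxE.
  apply: measurable_funM; first exact: measurable_wrtW (hv k i (ltn_ord k)).
  by case: hW => mW _ _ _; apply: measurable_funB; exact: mW.
(* Coefficients of |x| <= dl / 2 + x^2 / (2 dl) and of half of [energy_diff_le]. *)
pose a1 := (2 * dl)^-1.
pose a2 := 2^-1 * (1 + dl^-1).
have a10 : 0 <= a1 by rewrite invr_ge0 mulr_ge0// ltW.
have a20 : 0 <= a2 by rewrite /a2; lra.
pose Uw w := 2^-1 * dl * (1 + c * T) + (a1 * J w + a2 * D m w).
have u0 : 0 <= 2^-1 * dl * (1 + c * T) by rewrite !mulr_ge0 ?invr_ge0 ?ltW.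
have J0 w : 0 <= J w by exact: sqr_ge0.
exists (stopped_exponent (h m) C), Uw; split.
  split.
  - exact: measurable_stopped_exponent.
  - by apply: measurable_funD => //; apply: measurable_funD; exact: measurable_funM.
  - by move=> w; rewrite !addr_ge0// mulr_ge0.
split.
- exact: integral_stopped_exponential.
- exact: integral_stopped_exponential_sq.
- have mJE : measurable_fun setT (fun w => (J w)%:E) by exact/measurable_EFinP.
  have mDE : measurable_fun setT (fun w => (D m w)%:E) by exact/measurable_EFinP.
  rewrite (_ : (fun w => (Uw w)%:E) = fun w =>
    (2^-1 * dl * (1 + c * T))%:E + (a1%:E * (J w)%:E + a2%:E * (D m w)%:E))%E//.
  rewrite ge0_integralD//; last 2 first.
  + by move=> w _; rewrite -!EFinM -EFinD lee_fin; apply: addr_ge0; apply: mulr_ge0.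
  + by apply: emeasurable_funD; exact: emeasurable_funM.
  rewrite integral_cst// [X in (_ * X + _)%E](probability_setT P) mule1.
  rewrite ge0_integralD//; last 4 first.
  + by move=> w _; rewrite -!EFinM lee_fin; apply: mulr_ge0.
  + exact: emeasurable_funM.
  + by move=> w _; rewrite -!EFinM lee_fin; apply: mulr_ge0.
  + exact: emeasurable_funM.
  rewrite !ge0_integralZl_EFin//; try by move=> w _; rewrite lee_fin.
  apply: (@le_trans _ _ ((2^-1 * dl * (1 + c * T))%:E + (a1%:E * eta%:E + a2%:E * eta%:E)))%E.
    by rewrite leeD2l// leeD// lee_wpmul2l.
  rewrite -!EFinM -!EFinD lee_fin -mulrDl.
  have -> : a1 + a2 = 2^-1 + dl^-1 by rewrite /a1 /a2; field; rewrite gt_eqF.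
  rewrite /eta [_ * (_ / _)]mulrC divfK ?gt_eqF//.
  by move: dle; rewrite -mulrA; lra.
apply: filterS phic => w phicw.
have [sC|Cs] := leP (simple_energy (h m) (sp_size (h m)) w) C.
- left; rewrite (stopped_exponentE _ sC)//.
  have ed := energy_diff_le (ah m) (mphis w) (mdiffs m w) phicw dl0.
  set e := simple_energy _ _ _ in ed *.
  set i := simple_integral _ _ _ _.
  rewrite -/(q w) -/(D m w) in ed *.
  rewrite (_ : _ - _ = - (i - I w) - 2^-1 * (e - q w)); last by ring.
  rewrite (le_trans (ler_normB _ _))// normrN normrM (@ger0_norm _ 2^-1)//.
  have ij : `|i - I w| <= 2^-1 * dl + a1 * J w.
    have : 0 <= (`|i - I w| - dl) ^+ 2 / (2 * dl).
      by rewrite divr_ge0 ?sqr_ge0// mulr_ge0// ltW.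
    rewrite /a1 /J -/i -[(i - I w) ^+ 2]real_normK ?num_real//.
    rewrite (_ : _ / _ = (2 * dl)^-1 * `|i - I w| ^+ 2 - `|i - I w| + 2^-1 * dl); last first.
      by field; rewrite gt_eqF.
    lra.
  have : 2^-1 * `|e - q w| <= 2^-1 * ((1 + dl^-1) * D m w + dl * (c * T)).
    by rewrite ler_pM2l.
  rewrite /Uw /a2; lra.
- right; have := energy_le (ah m) (mphis w) (mdiffs m w) phicw.
  rewrite -/(D m w) => eD.
  have D1 : 1 <= D m w by move: Cs eD; rewrite /C; lra.
  rewrite /Uw (@le_trans _ _ (a2 * D m w))//; last first.
    by rewrite addrA lerDr addr_ge0// mulr_ge0.
  rewrite (le_trans D1)// ler_peMl//; rewrite /a2; lra.
Unshelve. all: by end_near. Qed.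

End ito_exponential.

(** * Expectations of real random variables *)

Section real_expectation.
Context {R : realType} {d : measure_display} {Omega : measurableType d}.
Variable P : probability Omega R.
Implicit Types f g : Omega -> R.
Local Notation integ f := (P.-integrable setT (EFin \o f)).

Lemma expectationE f : integ f -> ('E_P[f] = (\int[P]_w f w)%R%:E)%E.
Proof. by move=> fi; rewrite unlock /Rintegral fineK// (integrable_fin_num _ fi). Qed.

(** Feasible wealths are bounded almost surely only, whence the almost sure versions
of monotonicity and domination. *)
Lemma ae_le_integrable f g : measurable_fun setT f -> integ g ->
  {ae P, forall w, `|f w| <= `|g w|} -> integ f.
Proof.
move=> mf /integrableP[mg ig] fg; apply/integrableP; split; first exact/measurable_EFinP.
apply: le_lt_trans ig; apply: ae_ge0_le_integral => //.
- by apply: measurableT_comp => //; exact/measurable_EFinP.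
- exact: measurableT_comp.
- by apply: filterS fg => w h _; rewrite /= lee_fin.
Qed.

Lemma ae_bounded_integrable f (c : R) : measurable_fun setT f ->
  {ae P, forall w, `|f w| <= c} -> integ f.
Proof.
move=> mf fc; apply: (@ae_le_integrable _ (cst c)) => //.
  exact: finite_measure_integrable_cst.
by apply: filterS fc => w h /=; rewrite (le_trans h)// ler_norm.
Qed.

Lemma ae_le_Rintegral f g : integ f -> integ g ->
  {ae P, forall w, f w <= g w} -> \int[P]_w f w <= \int[P]_w g w.
Proof.
move=> fi gi fg; rewrite -subr_ge0 -RintegralB// /Rintegral fine_ge0//.
have mgf : measurable_fun setT (fun w => (g w - f w)%:E).
  by have := integrableB measurableT gi fi => /integrableP[].
rewrite (ae_eq_integral (fun w => `|(g w - f w)%:E|%E))//.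
- by apply: integral_ge0.
- exact: measurableT_comp.
- by apply: filterS fg => w h _; rewrite /= ger0_norm// subr_ge0.
Qed.

Lemma Rintegral_indicE (A : set Omega) : measurable A ->
  \int[P]_w (\1_A w : R) = fine (P A).
Proof. by move=> mA; rewrite /Rintegral integral_indic// setIT. Qed.

Lemma Rintegral_probability_cst (c : R) : \int[P]_w c = c.
Proof. by rewrite Rintegral_cst//= probability_setT mulr1. Qed.

Lemma integ_cst (c : R) : integ (fun=> c).
Proof. exact: finite_measure_integrable_cst. Qed.

Lemma Rintegral_eq0_ae f : integ f -> {ae P, forall w, 0 <= f w} ->
  \int[P]_w f w <= 0 -> {ae P, forall w, f w = 0}.
Proof.
move=> fi f0 If.
have mf : measurable_fun setT (EFin \o f) by move/integrableP: (fi) => [].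
have : (\int[P]_w `|(f w)%:E| = 0)%E.
  rewrite (ae_eq_integral (EFin \o f))//.
  - rewrite -[LHS]fineK ?(integrable_fin_num _ fi)//; congr EFin; apply/eqP.
    rewrite eq_le; apply/andP; split; first exact: If.
    have := ae_le_Rintegral (integ_cst 0) fi f0.
    by rewrite Rintegral_probability_cst.
  - exact: measurableT_comp.
  - by apply: filterS f0 => w h _; rewrite /= ger0_norm.
move/(ae_eq_integral_abs _ measurableT mf); apply: filterS => w /(_ Logic.I) [].
by [].
Qed.

Lemma bounded_Lfun2 f (c : R) : measurable_fun setT f -> (forall w, `|f w| <= c) ->
  f \in Lfun P 2%:E.
Proof.
move=> mf fc; rewrite inE/=; apply/andP; split; rewrite inE//=.
rewrite /finite_norm unlock poweR_lty//.
apply: (@le_lt_trans _ _ (\int[P]_w ((`|c| `^ 2)%:E)))%E.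
  apply: ge0_le_integral => //.
  - by move=> w _; exact: poweR_ge0.
  - apply: (measurableT_comp (measurable_poweR _)); apply: measurableT_comp => //.
    exact/measurable_EFinP.
  - move=> w _; rewrite /= lee_fin ge0_ler_powR ?nnegrE//.
    by rewrite (le_trans (fc w))// ler_norm.
by rewrite integral_cst//= probability_setT mule1 ltry.
Qed.

Lemma Lfun2_measurable f : f \in Lfun P 2%:E -> measurable_fun setT f.
Proof. by rewrite inE => /andP[/[!inE]]. Qed.

End real_expectation.

(** * The functions H0 and H1 *)

Section price_density.
Context {R : realType} {d : measure_display} {Omega : measurableType d}.
Variables (P : probability Omega R) (Z : Omega -> R).
Hypotheses (mZ : measurable_fun setT Z) (Z0 : {ae P, forall w, 0 < Z w}).
Hypotheses (hH1 : H1_invertible P Z) (e0 : 0 < EZ P Z).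
Local Notation integ f := (P.-integrable setT (EFin \o f)).
Local Notation H0 := (H P Z 0).
Local Notation H1 := (H P Z 1).
Local Notation H1inv := (H1inv P Z).
Local Notation e := (EZ P Z).
Local Notation below y := [set w | Z w <= y].

(** As EZ would be 0 if the expectation of Z were infinite, a positive EZ means that Z
is integrable. *)
Lemma integ_density : integ Z.
Proof.
apply/integrableP; split; first exact/measurable_EFinP.
have -> : (\int[P]_w `|(EFin \o Z) w| = \int[P]_w (Z w)%:E)%E.
  apply: ae_eq_integral => //; [|exact/measurable_EFinP|].
    by apply: measurableT_comp => //; exact/measurable_EFinP.
  by apply: filterS Z0 => w h _ /=; rewrite ger0_norm// ltW.
move: e0; rewrite /EZ unlock; case: integral => //=; rewrite ?ltxx//.
by move=> r _; exact: ltry.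
Qed.

Lemma EZE : e = \int[P]_w Z w.
Proof. by rewrite /EZ (expectationE integ_density). Qed.

Lemma measurable_below y : measurable (below y).
Proof.
rewrite (_ : below y = Z @^-1` `]-oo, y]); first by rewrite -[X in measurable X]setTI; exact: mZ.
by apply/seteqP; split => w /=; rewrite in_itv.
Qed.

Lemma integ_indic (A : set Omega) : measurable A -> integ (\1_A : Omega -> R).
Proof.
move=> mA; apply: (@ae_bounded_integrable _ _ _ _ _ 1); first exact: measurable_indic.
by apply: nearW => w; rewrite indicE; case: (_ \in _); rewrite /= ?normr1 ?normr0.
Qed.

Lemma integ_density_indic (A : set Omega) : measurable A ->
  integ (fun w => Z w * (\1_A w : R)).
Proof.
move=> mA; apply: (ae_le_integrable _ integ_density); first exact: measurable_funM.
apply: nearW => w; rewrite indicE normrM; case: (_ \in _); rewrite /= ?normr1 ?normr0 ?mulr1//.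
by rewrite mulr0.
Qed.

Let i0 y : integ (\1_(below y) : Omega -> R) := integ_indic (measurable_below y).
Let i1 y : integ (fun w => Z w * (\1_(below y) w : R)) := integ_density_indic (measurable_below y).

Lemma H0E y : H0 y = \int[P]_w (\1_(below y) w : R).
Proof.
rewrite /H (_ : (fun w => _) = (\1_(below y) : Omega -> R)); first by rewrite (expectationE (i0 y)).
by apply/funext => w; rewrite expr0 mul1r.
Qed.

Lemma H0P y : (H0 y)%:E = P (below y).
Proof. by rewrite H0E Rintegral_indicE ?fineK ?fin_num_measure//; exact: measurable_below. Qed.

Lemma H1E y : H1 y = \int[P]_w (Z w * (\1_(below y) w : R)).
Proof.
by rewrite /H; under eq_fun do rewrite expr1; rewrite (expectationE (i1 y)).
Qed.

Lemma mem_below y w : (w \in below y) = (Z w <= y).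
Proof. by apply/idP/idP; rewrite inE. Qed.

Let below_diff y1 y2 w : y1 <= y2 ->
  (\1_(below y2) w - \1_(below y1) w : R) = ((y1 < Z w <= y2)%R : bool)%:R.
Proof.
move=> y12; rewrite !indicE !mem_below.
have [Z1|Z1] := leP (Z w) y1; first by rewrite (le_trans Z1 y12) subrr.
by rewrite subr0.
Qed.

(** On the event where the two indicators differ, Z lies between y1 and y2. *)
Lemma H_increment_le y1 y2 : y1 <= y2 -> y1 * (H0 y2 - H0 y1) <= H1 y2 - H1 y1.
Proof.
move=> y12; rewrite !H0E !H1E -!RintegralB// -RintegralZl//; last exact: (integrableB _ (i0 y2) (i0 y1)).
apply: ae_le_Rintegral.
- exact: (integrableZl _ y1 (integrableB _ (i0 y2) (i0 y1))).
- exact: (integrableB _ (i1 y2) (i1 y1)).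
apply: nearW => w; rewrite -mulrBr below_diff//.
by case: (boolP (y1 < Z w <= y2)) => [/andP[/ltW ? _]|_]; rewrite ?mulr1 ?mulr0.
Qed.

Lemma H_increment_ge y1 y2 : y1 <= y2 -> H1 y2 - H1 y1 <= y2 * (H0 y2 - H0 y1).
Proof.
move=> y12; rewrite !H0E !H1E -!RintegralB// -RintegralZl//; last exact: (integrableB _ (i0 y2) (i0 y1)).
apply: ae_le_Rintegral.
- exact: (integrableB _ (i1 y2) (i1 y1)).
- exact: (integrableZl _ y2 (integrableB _ (i0 y2) (i0 y1))).
apply: nearW => w; rewrite -mulrBr below_diff//.
by case: (boolP (y1 < Z w <= y2)) => [/andP[_ ?]|_]; rewrite ?mulr1 ?mulr0.
Qed.

Lemma H_tail_le y : y * (1 - H0 y) <= e - H1 y.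
Proof.
have ic := integ_cst P 1.
rewrite EZE H0E H1E -{1}[1](Rintegral_probability_cst P) -!RintegralB//; last exact: integ_density.
rewrite -RintegralZl//; last exact: (integrableB _ ic (i0 y)).
apply: ae_le_Rintegral.
- exact: (integrableZl _ y (integrableB _ ic (i0 y))).
- exact: (integrableB _ integ_density (i1 y)).
apply: nearW => w.
rewrite (_ : Z w - _ = Z w * (1 - (\1_(below y) w : R))); last by ring.
rewrite indicE mem_below.
by case: (leP (Z w) y) => [_|/ltW]; rewrite ?subrr ?mulr0// subr0 !mulr1.
Qed.

Lemma H0_le1 y : H0 y <= 1.
Proof. by rewrite -lee_fin H0P probability_le1//; exact: measurable_below. Qed.

Lemma H0_ge0 y : 0 <= H0 y.
Proof. by rewrite -lee_fin H0P. Qed.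

Lemma H0_mono y1 y2 : y1 <= y2 -> H0 y1 <= H0 y2.
Proof.
move=> y12; rewrite -lee_fin !H0P; apply: le_measure; rewrite ?inE; try exact: measurable_below.
by move=> w /= /le_trans; exact.
Qed.

Lemma H1_mono y1 y2 : 0 <= y1 -> y1 <= y2 -> H1 y1 <= H1 y2.
Proof.
move=> y0 y12; rewrite -subr_ge0 (le_trans _ (H_increment_le y12))// mulr_ge0//.
by rewrite subr_ge0 H0_mono.
Qed.

Lemma H1_lt y1 y2 : 0 <= y1 -> y1 < y2 -> H1 y1 < H1 y2.
Proof.
move=> y0 y12; rewrite lt_neqAle H1_mono ?(ltW y12)// andbT; apply/eqP => H12.
have [_ inj _] := hH1.
have := inj y1 y2; rewrite !inE /= !in_itv/= !andbT => /(_ y0 (le_trans y0 (ltW y12)) H12) y12'.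
by rewrite y12' ltxx in y12.
Qed.

Lemma H1_lt_inv y1 y2 : 0 <= y2 -> H1 y1 < H1 y2 -> y1 < y2.
Proof.
move=> y20 H12; rewrite ltNge; apply/negP => y21.
by have := H1_mono y20 y21; rewrite leNgt H12.
Qed.

(** H1 increases strictly because it is injective, and [H_increment_ge] transfers this
to H0: the law of Z charges every interval of positive numbers. *)
Lemma H0_lt y1 y2 : 0 <= y1 -> y1 < y2 -> H0 y1 < H0 y2.
Proof.
move=> y0 y12; have y20 := le_lt_trans y0 y12.
have := H1_lt y0 y12; rewrite -subr_gt0 => /lt_le_trans/(_ (H_increment_ge (ltW y12))).
by rewrite pmulr_rgt0// subr_gt0.
Qed.

Lemma H1_range y : 0 <= y -> 0 <= H1 y < e.
Proof.
move=> y0; have [fH _ _] := hH1.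
by have := fH y; rewrite /= !in_itv/= andbT => /(_ y0).
Qed.

Lemma H1inv_ge0 u : 0 <= u < e -> 0 <= H1inv u.
Proof.
move=> ue; have [_ _ sH] := hH1.
have := surjpinv_image_sub (dflt := fun=> 0) sH; move=> /(_ (H1inv u)); rewrite /= in_itv/= andbT; apply.
by exists u => //=; rewrite in_itv.
Qed.

Lemma H1invK u : 0 <= u < e -> H1 (H1inv u) = u.
Proof.
move=> ue; have [_ _ sH] := hH1.
by apply: (surjpK (fun=> 0) sH); rewrite inE/= in_itv.
Qed.

Lemma H1K y : 0 <= y -> H1inv (H1 y) = y.
Proof.
move=> y0; have [_ inj _] := hH1.
by apply: (pinvKV (fun=> 0) inj); rewrite inE/= in_itv/= y0.
Qed.

Lemma below0 : P (below 0) = 0%E.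
Proof.
have [N [mN PN subN]] := Z0.
apply/eqP; rewrite eq_le measure_ge0 andbT -PN; apply: le_measure; rewrite ?inE//.
  exact: measurable_below.
by move=> w /= Zw; apply: subN => /=; rewrite ltNge Zw.
Qed.

Lemma H0_0 : H0 0 = 0.
Proof. by apply: EFin_inj; rewrite H0P below0. Qed.

Lemma H1_0 : H1 0 = 0.
Proof.
apply/eqP; rewrite eq_le; have /andP[-> _] := H1_range (lexx 0); rewrite andbT.
have [_ _ sH] := hH1; have : `[0, e[%classic 0 by rewrite /= in_itv/= lexx e0.
move=> /sH[y/=]; rewrite in_itv/= andbT => y0 Hy; rewrite -[leRHS]Hy.
exact: H1_mono.
Qed.

Lemma H1inv_0 : H1inv 0 = 0.
Proof. by rewrite -{1}H1_0 H1K. Qed.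

Lemma H1inv_gt0 u : 0 < u < e -> 0 < H1inv u.
Proof.
move=> /andP[u0 ue]; have u1 : 0 <= u < e by rewrite ltW.
by apply: H1_lt_inv; [exact: H1inv_ge0|rewrite H1_0 H1invK].
Qed.

Lemma H0_small eps : 0 < eps -> exists2 y, 0 < y & H0 y < eps.
Proof.
move=> eps0.
pose X : {RV P >-> R} := HB.pack Z (isMeasurableFun.Build _ _ _ _ _ mZ).
have cX r : cdf X r = (H0 r)%:E.
  by rewrite H0P /cdf /distribution /pushforward; congr (P _); apply/seteqP; split => w /=; rewrite in_itv.
have := @cdf_right_continuous _ _ _ P X 0.
rewrite cX H0_0 => /fine_cvgP[_ /cvgr0_norm_lt/(_ _ eps0)].
move=> near0; near (0 : R)^'+ => y; exists y; first by near: y; exact: nbhs_right_gt.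
apply: le_lt_trans (ler_norm _) _.
have -> : H0 y = (fine \o cdf X) y by rewrite /= cX.
by near: y.
Unshelve. all: by end_near. Qed.


(** H0 as a function of u = H1 y, extended by its limits 0 and 1 so that it is
continuous on the whole line and the boundary case b = +oo is a value of u. *)
Definition H0_of_H1 (u : R) : R :=
  if u < 0 then 0 else if u < e then H0 (H1inv u) else 1.

Local Notation G := H0_of_H1.

Lemma H0_of_H1_lt u : 0 <= u < e -> G u = H0 (H1inv u).
Proof. by move=> /andP[u0 ue]; rewrite /G ltNge u0/= ue. Qed.

Lemma H1inv_mono u v : 0 <= u -> u <= v -> v < e -> H1inv u <= H1inv v.
Proof.
move=> u0 uv ve; rewrite leNgt; apply/negP => h.
have v1 : 0 <= v < e by rewrite (le_trans u0).
have u1 : 0 <= u < e by rewrite u0 (le_lt_trans uv).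
by have := H1_lt (H1inv_ge0 v1) h; rewrite !H1invK// ltNge uv.
Qed.

Lemma H0_of_H1_mono u v : u <= v -> G u <= G v.
Proof.
move=> uv; rewrite /G.
have [v0|v0] := ltP v 0; first by rewrite (le_lt_trans uv v0).
have [u0|u0] := ltP u 0; first by case: ifP => // _; exact: H0_ge0.
have [ve|ve] := ltP v e; first by rewrite (le_lt_trans uv ve) H0_mono// H1inv_mono.
by case: ifP => // _; exact: H0_le1.
Qed.

(** The derivative of H0 with respect to H1 is 1 / y, bounded when y stays away
from 0. *)
Lemma H0_of_H1_lipschitz t u v : 0 < t < e -> t <= u -> u <= v ->
  G v - G u <= (H1inv t)^-1 * (v - u).
Proof.
move=> /[dup] tte /andP[t0 te] tu uv.
have it := H1inv_gt0 tte.
have u0 : 0 <= u by rewrite (le_trans (ltW t0)).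
have v0 : 0 <= v by rewrite (le_trans u0).
rewrite /G !ltNge u0 v0/=.
have [eu|ue] := leP e u.
  by rewrite (le_trans eu uv)/= subrr mulr_ge0// ?subr_ge0// invr_ge0 ltW.
have ue1 : 0 <= u < e by rewrite u0.
have tu' := H1inv_mono (ltW t0) tu ue.
rewrite ler_pdivlMl//.
have [ev|ve]/= := leP e v.
  apply: (@le_trans _ _ (H1inv u * (1 - H0 (H1inv u)))).
    by rewrite ler_wpM2r// subr_ge0 H0_le1.
  by rewrite (le_trans (H_tail_le _))// H1invK// lerD2r.
have ve1 : 0 <= v < e by rewrite v0.
have uv' := H1inv_mono u0 uv ve.
apply: (@le_trans _ _ (H1inv u * (H0 (H1inv v) - H0 (H1inv u)))).
  by rewrite ler_wpM2r// subr_ge0 H0_mono.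
by rewrite (le_trans (H_increment_le uv'))// !H1invK.
Qed.

Lemma H0_of_H1_continuous : continuous G.
Proof.
move=> x; apply/cvgrPdist_lt => eps eps0.
have [x0|x0|x0] := ltgtP x 0.
- near=> y; have y0 : y < 0 by near: y; exact: lt_nbhsl.
  by rewrite /G x0 y0 subrr normr0.
- pose t := Num.min (x / 2) (e / 2).
  have t0 : 0 < t by rewrite lt_min !divr_gt0.
  have te : 0 < t < e by rewrite t0 gt_min ltr_pdivrMr// [X in _ || X]ltr_pdivrMr// ltr_pMr// ltr1n orbT.
  have tx : t <= x / 2 by rewrite ge_min lexx.
  have it := H1inv_gt0 te.
  near=> y.
  have ty : t <= y.
    rewrite (le_trans tx)// ltW//; near: y; apply: lt_nbhsr; lra.
  have tx' : t <= x by lra.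
  apply: (@le_lt_trans _ _ ((H1inv t)^-1 * `|x - y|)).
    have [xy|/ltW yx] := leP x y.
      rewrite distrC ger0_norm ?subr_ge0 ?H0_of_H1_mono// distrC ger0_norm ?subr_ge0//.
      exact: H0_of_H1_lipschitz.
    rewrite ger0_norm ?subr_ge0 ?H0_of_H1_mono// ger0_norm ?subr_ge0//.
    exact: H0_of_H1_lipschitz.
  rewrite ltr_pdivrMl//; near: y; apply: cvgr_dist_lt; last by rewrite mulr_gt0.
  exact: cvg_id.
- have [y0 y00 Hy0] := H0_small eps0.
  have H10 : 0 < H1 y0 by rewrite -H1_0 H1_lt.
  have Gx : G x = 0 by rewrite x0 H0_of_H1_lt ?lexx ?e0// H1inv_0 H0_0.
  near=> u; have uy : u < H1 y0 by near: u; rewrite x0; exact: lt_nbhsl.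
  rewrite Gx sub0r normrN /G; have [u0|u0] := ltP u 0; first by rewrite normr0.
  have /andP[_ ye] := H1_range (ltW y00).
  rewrite (lt_trans uy ye) ger0_norm ?H0_ge0// (le_lt_trans _ Hy0)// H0_mono//.
  by rewrite -(H1K (ltW y00)) H1inv_mono// ltW.
Unshelve. all: by end_near. Qed.

(** * Existence and uniqueness of the thresholds *)

Section thresholds.
Variables (w0 A b D K : R).
Hypotheses (A0 : 0 < A) (b0 : 0 < b) (D0 : 0 < D) (w00 : 0 < w0) (w0e : w0 < (A + b) * e).

(* The risk along the budget line A u + b v = w0, where u and v are the values of H1
   at the two thresholds; u1 is where v reaches E[Z], or 0 if it never does, and u2
   is where u = v. *)
Let risk_curve u := A * G u + D * (1 - G ((w0 - A * u) / b)).

Let u1 := if w0 < b * e then 0 else (w0 - b * e) / A.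
Let u2 := w0 / (A + b).

(** If a1 < a2, the budget forces b1 > b2 and both terms of the risk increase. *)
Lemma thresholds_unique a1 b1 a2 b2 :
  0 < a1 -> 0 < b1 -> 0 < a2 -> 0 < b2 ->
  A * H1 a1 + b * H1 b1 = w0 -> A * H0 a1 + D * (1 - H0 b1) = K ->
  A * H1 a2 + b * H1 b2 = w0 -> A * H0 a2 + D * (1 - H0 b2) = K ->
  a1 = a2 /\ b1 = b2.
Proof.
wlog a12 : a1 b1 a2 b2 / a1 <= a2.
  move=> hw; have [/hw|/ltW/hw h] := leP a1 a2; first exact.
  move=> p1 p2 p3 p4 e1 e2 e3 e4; by have [-> ->] := h _ _ p3 p4 p1 p2 e3 e4 e1 e2.
move=> a10 b10 a20 b20 e1 e2 e3 e4.
move: a12; rewrite le_eqVlt => /predU1P[a12|a12].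
  have H12 : H1 b1 = H1 b2.
    apply: (mulfI (negbT (gt_eqF b0))); rewrite a12 in e1; lra.
  by split => //; rewrite -(H1K (ltW b10)) H12 H1K// ltW.
have h1 := H1_lt (ltW a10) a12; have h0 := H0_lt (ltW a10) a12.
have hA : A * H1 a1 < A * H1 a2 by rewrite ltr_pM2l.
have hb : H1 b2 < H1 b1 by rewrite -(ltr_pM2l b0); lra.
have b21 := H1_lt_inv (ltW b10) hb.
have hb0 := H0_lt (ltW b20) b21.
suff : K < K by rewrite ltxx.
by rewrite -{1}e2 -e4; apply: ltrD; rewrite ltr_pM2l//; lra.
Qed.

Lemma thresholds_exist :
  risk_curve u1 < K < risk_curve u2 ->
  exists a b', [/\ 0 < a, a < b', A * H1 a + b * H1 b' = w0 & A * H0 a + D * (1 - H0 b') = K].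
Proof.
move=> /andP[K1 K2].
have Ab0 : 0 < A + b by rewrite addr_gt0.
have u10 : 0 <= u1.
  rewrite /u1; case: ltP => // h; apply: divr_ge0; [lra|exact: ltW].
have u12 : u1 <= u2.
  rewrite /u1 /u2; case: ltP => h; first by rewrite divr_ge0 ?ltW.
  rewrite ler_pdivrMr// mulrAC ler_pdivlMr//; have := ler_wpM2l (ltW b0) (ltW w0e); lra.
have ck : continuous risk_curve.
  move=> x; rewrite /risk_curve; apply: cvgD.
    by apply: cvgMr; exact: H0_of_H1_continuous.
  apply: cvgMr; apply: cvgB; first exact: cvg_cst.
  apply: (cvg_comp (fun u => (w0 - A * u) / b) G); last exact: H0_of_H1_continuous.
  apply: cvgMl; apply: cvgB; first exact: cvg_cst.
  by apply: cvgMr; exact: cvg_id.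
have [|u] := IVT u12 (continuous_subspaceT ck) (v := K).
  by rewrite ge_min le_max (ltW K1) (ltW K2) orbT.
rewrite in_itv/= => /andP[uu1 uu2] ku.
have {}uu1 : u1 < u by rewrite lt_neqAle uu1 andbT; apply: contraTneq K1 => ->; rewrite ku ltxx.
have {}uu2 : u < u2 by rewrite lt_neqAle uu2 andbT; apply: contraTneq K2 => <-; rewrite ku ltxx.
pose v := (w0 - A * u) / b.
have bv : A * u + b * v = w0 by rewrite /v mulrC; field; rewrite gt_eqF.
have u0 := le_lt_trans u10 uu1.
have uv : u < v.
  move: uu2; rewrite /u2 ltr_pdivlMr// => h; rewrite /v ltr_pdivlMr//; lra.
have ve : v < e.
  rewrite /v ltr_pdivrMr//; move: uu1; rewrite /u1; case: (ltP w0 (b * e)) => h.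
    by move=> _; have := mulr_gt0 A0 u0; lra.
  by rewrite ltr_pdivrMr//; lra.
have ue : 0 < u < e by rewrite u0 (lt_trans uv).
have vve : 0 < v < e by rewrite (lt_trans u0 uv).
have u_le : 0 <= u < e by case/andP: ue => /ltW -> ->.
have v_le : 0 <= v < e by case/andP: vve => /ltW -> ->.
exists (H1inv u), (H1inv v); split.
- exact: H1inv_gt0.
- by apply: H1_lt_inv; [exact: H1inv_ge0|rewrite !H1invK].
- by rewrite !H1invK.
- by rewrite -!H0_of_H1_lt.
Qed.

Lemma risk_curve_lower :
  risk_curve u1 = if w0 < b * e then D * (1 - H0 (H1inv (w0 / b)))
              else A * H0 (H1inv ((w0 - b * e) / A)).
Proof.
rewrite /risk_curve /u1; case: ltP => h.
  rewrite mulr0 subr0 (@H0_of_H1_lt (w0 / b)); last first.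
    by rewrite divr_ge0 ?ltW//= ltr_pdivrMr// mulrC.
  by rewrite H0_of_H1_lt ?lexx ?e0// H1inv_0 H0_0 mulr0 add0r.
have -> : (w0 - A * ((w0 - b * e) / A)) / b = e by field; rewrite !gt_eqF.
rewrite {2}/G ltxx ltNge (ltW e0)/= subrr mulr0 addr0 H0_of_H1_lt//.
rewrite divr_ge0 ?subr_ge0 ?(ltW A0)//= ltr_pdivrMr//; move: w0e; rewrite mulrDl [e * A]mulrC; lra.
Qed.

Lemma risk_curve_upper :
  risk_curve u2 = A * H0 (H1inv (w0 / (A + b))) + D * (1 - H0 (H1inv (w0 / (A + b)))).
Proof.
have Ab0 : 0 < A + b by rewrite addr_gt0.
rewrite /risk_curve /u2.
have -> : (w0 - A * (w0 / (A + b))) / b = w0 / (A + b) by field; rewrite !gt_eqF.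
by rewrite H0_of_H1_lt// divr_ge0 ?ltW//= ltr_pdivrMr// mulrC.
Qed.

Lemma thresholds_between :
  (if w0 < b * e then D * (1 - H0 (H1inv (w0 / b)))
   else A * H0 (H1inv ((w0 - b * e) / A))) < K <
  A * H0 (H1inv (w0 / (A + b))) + D * (1 - H0 (H1inv (w0 / (A + b)))) ->
  exists a b', [/\ 0 < a, a < b', A * H1 a + b * H1 b' = w0 & A * H0 a + D * (1 - H0 b') = K].
Proof. by rewrite -risk_curve_lower -risk_curve_upper; exact: thresholds_exist. Qed.

End thresholds.

End price_density.

(** * Lagrangian duality *)

Section pointwise_lagrangian.
Context {R : realType}.
Variables (B alpha c : R).
Hypotheses (c1 : 1 <= c) (a0 : 0 < - alpha) (aB : 0 < B + alpha).

(** Integrand of the Rockafellar-Uryasev formula for the conditional value-at-risk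
of - m, with alpha playing the part of the value-at-risk. *)
Definition tail_loss (m : R) : R := m + alpha + c * Num.max (- m - alpha) 0.

Local Notation loss := tail_loss.

Lemma loss_ge m : m + alpha <= loss m.
Proof. by rewrite /tail_loss lerDl mulr_ge0 ?le_max ?lexx ?orbT// (le_trans ler01). Qed.

Lemma loss_above m : - alpha <= m -> loss m = m + alpha.
Proof.
move=> h; rewrite /tail_loss (_ : Num.max _ _ = 0) ?mulr0 ?addr0//.
by apply/max_idPr; lra.
Qed.

Lemma loss_below m : m <= - alpha -> loss m = (1 - c) * (m + alpha).
Proof.
move=> h; rewrite /tail_loss (_ : Num.max _ _ = - m - alpha); first by ring.
by apply/max_idPl; lra.
Qed.

Lemma loss_ge0 m : 0 <= loss m.
Proof.
have [h|/ltW h] := leP (- alpha) m; first by rewrite loss_above//; lra.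
rewrite loss_below//; apply: mulr_le0.
  by rewrite subr_le0.
lra.
Qed.

Lemma loss_eq0 m : 1 < c -> loss m = 0 -> m = - alpha.
Proof.
move=> c2; have [h|/ltW h] := leP (- alpha) m; first by rewrite loss_above//; lra.
rewrite loss_below// => /eqP; rewrite mulf_eq0 => /orP[/eqP h1|/eqP h1]; first by exfalso; lra.
lra.
Qed.

Definition three_step (a b : R) (z : R) : R :=
  if z <= a then B else if z <= b then - alpha else 0.

(** On each side of the kink the function of m is affine with slope et z - (1 - la)
above and et z - (la (c - 1) + 1) below; the position of z with respect to the two
thresholds decides the signs of both slopes. *)
Lemma three_step_minimizes (la et z m : R) :
  0 <= la -> la <= 1 -> 0 < et -> 0 <= m <= B ->
  let ms := three_step ((1 - la) / et) ((la * (c - 1) + 1) / et) z in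
  - ms + la * loss ms + et * (z * ms) <= - m + la * loss m + et * (z * m).
Proof.
move: (c1) (a0) (aB) => c1' a0' aB' la0 la1 et0 /andP[m0 mB] /=; rewrite /three_step.
have lc : 0 <= la * (c - 1) by rewrite mulr_ge0// subr_ge0.
have [za|az] := leP z ((1 - la) / et).
  rewrite ler_pdivlMr// in za.
  have zm : z * et + la - 1 <= 0 by lra.
  rewrite (@loss_above B); last by lra.
  have h1 : 0 <= (1 - la - z * et) * (B - m) by rewrite mulr_ge0; lra.
  have [h|/ltW h] := leP (- alpha) m.
    by rewrite (loss_above h); nra.
  rewrite (loss_below h).
  have h2 : 0 <= (la * c) * (- alpha - m) by rewrite mulr_ge0 ?mulr_ge0//; lra.
  nra.
rewrite ltr_pdivrMr// in az.
have [zb|bz] := leP z ((la * (c - 1) + 1) / et).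
  rewrite ler_pdivlMr// in zb.
  rewrite (@loss_above (- alpha)); last by lra.
  have [h|/ltW h] := leP (- alpha) m.
    rewrite (loss_above h).
    have h1 : 0 <= (z * et - (1 - la)) * (m + alpha) by rewrite mulr_ge0; lra.
    nra.
  rewrite (loss_below h).
  have h1 : 0 <= (la * (c - 1) + 1 - z * et) * (- alpha - m) by rewrite mulr_ge0; lra.
  nra.
rewrite ltr_pdivrMr// in bz.
rewrite (@loss_below 0); last by lra.
have [h|/ltW h] := leP (- alpha) m.
  rewrite (loss_above h).
  have h1 : 0 <= (z * et - (la * (c - 1) + 1)) * m by rewrite mulr_ge0//; lra.
  have h2 : 0 <= (la * c) * (m + alpha) by rewrite mulr_ge0 ?mulr_ge0//; lra.
  nra.
rewrite (loss_below h).
have h1 : 0 <= (z * et - (la * (c - 1) + 1)) * m by rewrite mulr_ge0//; lra.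
nra.
Qed.

End pointwise_lagrangian.

(** * Solutions of the constrained problem *)

Section problem_solution.
Context {R : realType} {d : measure_display} {Omega : measurableType d}.
Variables (P : probability Omega R) (Z : Omega -> R) (FT : set (set Omega)).
Hypotheses (mZ : measurable_fun setT Z) (Z0 : {ae P, forall w, 0 < Z w}).
Hypotheses (hH1 : H1_invertible P Z) (e0 : 0 < EZ P Z) (ZFT : measurable_wrt FT Z).
Variables (w0 B kappa alpha K : R).
Let c := (1 - kappa)^-1.
Hypotheses (c1 : 1 < c) (a0 : 0 < - alpha) (aB : 0 < B + alpha).
Local Notation integ f := (P.-integrable setT (EFin \o f)).
Local Notation loss := (tail_loss alpha c).
Local Notation H0 := (H P Z 0).
Local Notation H1 := (H P Z 1).
Local Notation e := (EZ P Z).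
Local Notation sol := (solves P Z FT w0 B kappa alpha K).
Local Notation feas := (feasible P Z FT w0 B kappa alpha K).

Let iZ := integ_density mZ Z0 e0.
Let c1' : 1 <= c := ltW c1.

Lemma measurable_loss : measurable_fun setT loss.
Proof.
apply: measurable_funD; first exact: measurable_funD.
apply: measurable_funM => //; apply: measurable_maxr => //.
by apply: measurable_funB => //; exact: measurableT_comp.
Qed.

Section admissible.
Variable M : Omega -> R.
Hypotheses (mM : measurable_fun setT M) (bM : {ae P, forall w, 0 <= M w <= B}).

Lemma integ_wealth : integ M.
Proof.
apply: (ae_bounded_integrable mM (c := B)).
by apply: filterS bM => w /andP[M0 MB]; rewrite ger0_norm.
Qed.

Lemma integ_budget : integ (fun w => Z w * M w).
Proof.
have iBZ : integ (fun w => B * Z w) by exact: (integrableZl _ B iZ).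
apply: (ae_le_integrable _ iBZ); first exact: measurable_funM.
apply: filterS bM => w /andP[M0 MB]; rewrite mulrC !normrM ler_wpM2r//.
by rewrite !ger0_norm// (le_trans M0).
Qed.

Lemma integ_loss : integ (fun w => loss (M w)).
Proof.
apply: (ae_bounded_integrable (c := B + `|alpha| + c * (B + `|alpha|))).
  exact: (measurableT_comp measurable_loss).
apply: filterS bM => w /andP[M0 MB].
have c0 : 0 <= c := le_trans ler01 c1'.
rewrite /tail_loss (le_trans (ler_normD _ _))// lerD//.
  by rewrite (le_trans (ler_normD _ _))// lerD2r ger0_norm.
rewrite normrM (ger0_norm c0) ler_wpM2l// ger0_norm ?le_max ?lexx ?orbT//.
rewrite ge_max; apply/andP; split; last by rewrite addr_ge0// (le_trans M0).
have := ler_norm (- alpha); rewrite normrN; lra.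
Qed.

End admissible.

Lemma feasible_real M : feas M ->
  [/\ measurable_fun setT M, {ae P, forall w, 0 <= M w <= B},
      \int[P]_w loss (M w) <= K & \int[P]_w (Z w * M w) = w0].
Proof.
case=> -[/Lfun2_measurable mM _] risk budget bM; split => //.
  by move: risk; rewrite (expectationE (integ_loss mM bM)) lee_fin.
by move: budget; rewrite (expectationE (integ_budget mM bM)) => -[].
Qed.

Lemma bounded_feasible M : measurable_fun setT M -> measurable_wrt FT M ->
  (forall w, 0 <= M w <= B) ->
  \int[P]_w loss (M w) <= K -> \int[P]_w (Z w * M w) = w0 -> feas M.
Proof.
move=> mM FM bM risk budget.
have aM : {ae P, forall w, 0 <= M w <= B} by exact: nearW.
split => //.
- split => //; apply: (bounded_Lfun2 _ mM (c := B)) => w.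
  by have /andP[M0 MB] := bM w; rewrite ger0_norm.
- by rewrite (expectationE (integ_loss mM aM)) lee_fin.
- by rewrite (expectationE (integ_budget mM aM)) budget.
Qed.

Lemma objective_le M M' : integ M -> integ M' ->
  \int[P]_w M' w <= \int[P]_w M w -> (- 'E_P[M] <= - 'E_P[M'])%E.
Proof. by move=> iM iM' h; rewrite leeN2 !expectationE// lee_fin. Qed.

(** The loss dominates m + alpha, so the risk constraint also bounds the mean. *)
Lemma mean_le_risk M : feas M -> \int[P]_w M w <= K - alpha.
Proof.
move=> /feasible_real[mM bM risk _].
have iM := integ_wealth mM bM; have ic := integ_cst P alpha.
rewrite lerBrDr -[X in _ + X](Rintegral_probability_cst P) -RintegralD//.
apply: le_trans risk; apply: ae_le_Rintegral.
- exact: (integrableD _ iM ic).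
- exact: integ_loss.
- by apply: nearW => w; exact: (loss_ge alpha c1').
Qed.

(** Above - alpha the loss equals m + alpha: the bound [mean_le_risk] is attained. *)
Lemma solves_of_binding_risk M : feas M -> {ae P, forall w, - alpha <= M w} ->
  \int[P]_w loss (M w) = K -> sol M.
Proof.
move=> fM aM rM; split => // M' fM'.
have [mM bM _ _] := feasible_real fM; have [mM' bM' _ _] := feasible_real fM'.
have iM := integ_wealth mM bM; have ic := integ_cst P alpha.
apply: objective_le => //; first exact: integ_wealth.
rewrite (le_trans (mean_le_risk fM'))// -rM lerBlDr.
rewrite -[X in _ + X](Rintegral_probability_cst P) -RintegralD//.
apply: ae_le_Rintegral; [exact: integ_loss|exact: (integrableD _ iM ic)|].
by apply: filterS aM => w h; rewrite (loss_above c h).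
Qed.

Lemma three_step_bounds a b z : 0 <= three_step B alpha a b z <= B.
Proof. by move: (a0) (aB) => ? ?; rewrite /three_step; case: ifP => _; [|case: ifP => _]; lra. Qed.

Lemma measurable_three_step a b : measurable_fun setT (three_step B alpha a b).
Proof.
apply: measurable_fun_ifT => //; first exact: measurable_fun_ler.
by apply: measurable_fun_ifT => //; exact: measurable_fun_ler.
Qed.

Lemma measurable_wrt_comp (g : R -> R) : measurable_fun setT g ->
  measurable_wrt FT (g \o Z).
Proof.
move=> mg C mC; rewrite comp_preimage; apply: ZFT.
by rewrite -[X in measurable X]setTI; exact: mg.
Qed.

Section two_thresholds.
Variables (a b : R).
Hypothesis ab : a <= b.
Local Notation below y := [set w | Z w <= y].

Lemma MstarE : Mstar Z B alpha a%:E b%:E = three_step B alpha a b \o Z.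
Proof.
apply/funext => w; rewrite /Mstar /three_step /= mul0r addr0 !indicE.
have -> : (w \in C1 Z a%:E) = (Z w <= a) by apply/idP/idP; rewrite inE /C1/= lee_fin.
have -> : (w \in C2 Z a%:E b%:E) = (a < Z w <= b).
  by apply/idP/idP; rewrite inE /C2/= lte_fin lee_fin.
by case: leP => h; case: leP => h'; rewrite /= ?mulr1 ?mulr0 ?subr0 ?sub0r ?add0r.
Qed.

Lemma integ_below_indic y : integ (\1_(below y) : Omega -> R).
Proof. by apply: integ_indic; exact: measurable_below. Qed.

Lemma integ_Z_below y : integ (fun w => Z w * (\1_(below y) w : R)).
Proof. by apply: integ_density_indic => //; exact: measurable_below. Qed.

Lemma risk_three_step : \int[P]_w loss (three_step B alpha a b (Z w)) =
  (B + alpha) * H0 a + (- alpha * (c - 1)) * (1 - H0 b).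
Proof.
have i1 := integ_cst P 1; have ia := integ_below_indic a; have ib := integ_below_indic b.
have id : integ (fun w => 1 - (\1_(below b) w : R)) by exact: (integrableB _ i1 ib).
have -> : \int[P]_w loss (three_step B alpha a b (Z w)) =
    \int[P]_w ((B + alpha) * (\1_(below a) w : R) +
    (- alpha * (c - 1)) * (1 - (\1_(below b) w : R))).
  apply: eq_Rintegral => w _; rewrite !indicE !mem_below /three_step.
  have [Za|Za] := leP (Z w) a.
    rewrite (le_trans Za ab) loss_above/=; first by ring.
    by move: (aB); lra.
  have [Zb|Zb] := leP (Z w) b; first by rewrite loss_above//=; ring.
  by rewrite loss_below/=; [ring|rewrite ltW].
rewrite RintegralD//; last 2 first.
- exact: (integrableZl _ (B + alpha) ia).
- exact: (integrableZl _ (- alpha * (c - 1)) id).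
rewrite !RintegralZl// RintegralB// Rintegral_probability_cst.
by rewrite !H0E.
Qed.

Lemma budget_three_step : \int[P]_w (Z w * three_step B alpha a b (Z w)) =
  (B + alpha) * H1 a + - alpha * H1 b.
Proof.
have ia := integ_Z_below a; have ib := integ_Z_below b.
have -> : \int[P]_w (Z w * three_step B alpha a b (Z w)) =
    \int[P]_w ((B + alpha) * (Z w * (\1_(below a) w : R)) +
    (- alpha) * (Z w * (\1_(below b) w : R))).
  apply: eq_Rintegral => w _; rewrite !indicE !mem_below /three_step.
  have [Za|Za] := leP (Z w) a; first by rewrite (le_trans Za ab)/=; ring.
  by have [Zb|Zb] := leP (Z w) b; rewrite /=; ring.
rewrite RintegralD//; last 2 first.
- exact: (integrableZl _ (B + alpha) ia).
- exact: (integrableZl _ (- alpha) ib).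
by rewrite !RintegralZl// !(H1E mZ Z0 e0).
Qed.

Let C1E : C1 Z a%:E = below a.
Proof. by apply/seteqP; split => w; rewrite /C1/= lee_fin. Qed.

Let C2E : C2 Z a%:E b%:E = below b `\` below a.
Proof.
apply/seteqP; split => w; rewrite /C2/= lte_fin lee_fin.
  by move=> /andP[h1 h2]; split => //; apply/negP; rewrite -ltNge.
by move=> [h1 /negP]; rewrite -ltNge => h2; apply/andP.
Qed.

Let C3E : C3 Z b%:E = ~` below b.
Proof.
by apply/seteqP; split => w; rewrite /C3/= lte_fin ltNge => /negP.
Qed.

Let mb y : measurable (below y) := measurable_below mZ y.

Lemma risk_valueE : risk_value P Z B kappa alpha a%:E b%:E =
  ((B + alpha) * H0 a + (- alpha * (c - 1)) * (1 - H0 b) - alpha)%:E.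
Proof.
have Pba : P (below b `\` below a) = (H0 b - H0 a)%:E.
  rewrite measureD//; last by rewrite ltey_eq fin_num_measure.
  have -> : below b `&` below a = below a.
    by apply/setIidPr => w /= /le_trans; exact.
  by rewrite EFinB !(H0P P mZ).
have Pb : P (~` below b) = (1 - H0 b)%:E by rewrite probability_setC// EFinB (H0P P mZ).
rewrite /risk_value C1E C2E C3E Pba Pb -(H0P P mZ) -!EFinM -!EFinB.
by apply: (f_equal EFin); rewrite -/c; ring.
Qed.

Lemma budget_valueE : budget_value P Z B alpha a%:E b%:E =
  ((B + alpha) * H1 a + - alpha * H1 b)%:E.
Proof.
rewrite /budget_value C1E C2E.
have ia := integ_Z_below a; have ib := integ_Z_below b.
rewrite (expectationE ia).
have -> : (fun w => Z w * (\1_(below b `\` below a) w : R)) =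
    (fun w => Z w * (\1_(below b) w : R) - Z w * (\1_(below a) w : R)).
  apply/funext => w; rewrite !indicE in_setD !mem_below -mulrBr; congr (_ * _).
  by have [Za|Za] := leP (Z w) a; rewrite ?(le_trans Za ab) ?subrr ?andbF//= subr0 andbT.
have id := integrableB measurableT ib ia.
rewrite (expectationE (f := fun w => Z w * (\1_(below b) w : R) - Z w * (\1_(below a) w : R)) id).
rewrite RintegralB// -!(H1E mZ Z0 e0) -!EFinM -EFinB; congr EFin; ring.
Qed.

End two_thresholds.

Section one_threshold.
Variable a : R.
Local Notation below y := [set w | Z w <= y].
Let two_step (z : R) : R := if z <= a then B else - alpha.

(** With an infinite upper threshold, the middle value - alpha is the lowest one. *)
Lemma MstarE_infty : Mstar Z B alpha a%:E +oo%E = two_step \o Z.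
Proof.
apply/funext => w; rewrite /Mstar /two_step /= mul0r addr0 !indicE.
have -> : (w \in C1 Z a%:E) = (Z w <= a) by apply/idP/idP; rewrite inE /C1/= lee_fin.
have -> : (w \in C2 Z a%:E +oo%E) = (a < Z w).
  by apply/idP/idP; rewrite inE /C2/= lte_fin leey andbT.
by case: leP => h; rewrite /= ?mulr1 ?mulr0 ?subr0 ?sub0r.
Qed.

Lemma solves_infty : (B + alpha) * H0 a = K ->
  (B + alpha) * H1 a + - alpha * e = w0 ->
  sol (Mstar Z B alpha a%:E +oo%E).
Proof.
move=> rK bw0; rewrite MstarE_infty; move: (a0) (aB) => a0' aB'.
have m2 : measurable_fun setT two_step.
  by apply: measurable_fun_ifT => //; exact: measurable_fun_ler.
have mM : measurable_fun setT (two_step \o Z) by exact: measurableT_comp.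
have bM w : - alpha <= (two_step \o Z) w <= B.
  by rewrite /= /two_step; case: ifP => _; lra.
have bM0 w : 0 <= (two_step \o Z) w <= B by have := bM w; lra.
have ia := integ_below_indic a; have iza := integ_Z_below a.
have risk : \int[P]_w loss ((two_step \o Z) w) = K.
  rewrite -rK H0E// -RintegralZl//; apply: eq_Rintegral => w _.
  rewrite loss_above; last by have /andP[] := bM w.
  by rewrite indicE mem_below /= /two_step; case: ifP => _ /=; ring.
have budget : \int[P]_w (Z w * (two_step \o Z) w) = w0.
  rewrite -bw0 (H1E mZ Z0 e0) (EZE mZ Z0 e0).
  rewrite -(RintegralZl _ measurableT iza) -(RintegralZl _ measurableT iZ) -RintegralD//; last 2 first.
  - exact: (integrableZl _ (B + alpha) iza).
  - exact: (integrableZl _ (- alpha) iZ).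
  apply: eq_Rintegral => w _.
  by rewrite indicE mem_below /= /two_step; case: ifP => _ /=; ring.
apply: solves_of_binding_risk => //.
  apply: bounded_feasible => //; last by rewrite risk.
  exact: measurable_wrt_comp.
by apply: nearW => w; have /andP[] := bM w.
Qed.

End one_threshold.

Lemma solves_cst : K = 0 -> w0 = - alpha * e -> sol (fun=> - alpha).
Proof.
move=> K0 w0E; move: (a0) (aB) => a0' aB'.
have loss0 : loss (- alpha) = 0 by rewrite loss_above//; ring.
have risk : \int[P]_w loss (- alpha) = 0 by rewrite loss0 Rintegral_probability_cst.
apply: solves_of_binding_risk; [|by apply: nearW|by rewrite risk K0].
apply: bounded_feasible => //.
- by apply: (@measurable_wrt_comp (fun=> - alpha)); exact: measurable_cst.
- by move=> _; lra.
- by rewrite risk K0.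
- rewrite w0E (EZE mZ Z0 e0) -(RintegralZl _ measurableT iZ).
  by apply: eq_Rintegral => w _; rewrite mulrC.
Qed.

Lemma feasible_unique M : K = 0 -> feas M -> {ae P, forall w, M w = - alpha}.
Proof.
move=> K0 /feasible_real[mM bM risk _].
have := Rintegral_eq0_ae (integ_loss mM bM); rewrite -K0 => h.
have : {ae P, forall w, loss (M w) = K}.
  by apply: h => //; apply: nearW => w; rewrite K0; exact: loss_ge0.
by apply: filterS => w; rewrite K0; apply: loss_eq0.
Qed.

(** Compared on M* and on a feasible M', the Lagrangians share the budget term; the
risk terms compare in the right direction by complementary slackness. *)
Lemma duality_solves (la et : R) :
  0 <= la -> la <= 1 -> 0 < et ->
  let a := (1 - la) / et in let b := (la * (c - 1) + 1) / et in
  let rho := (B + alpha) * H0 a + (- alpha * (c - 1)) * (1 - H0 b) in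
  rho <= K -> la * (rho - K) = 0 ->
  (B + alpha) * H1 a + - alpha * H1 b = w0 ->
  sol (Mstar Z B alpha a%:E b%:E).
Proof.
move=> la0 la1 et0 a b rho rhoK slack budget.
have ab : a <= b.
  rewrite /a /b ler_pM2r ?invr_gt0//.
  have := mulr_ge0 la0 (ltW (lt_le_trans ltr01 c1')); lra.
rewrite MstarE//.
set M := _ \o Z.
have mM : measurable_fun setT M by apply: measurableT_comp => //; exact: measurable_three_step.
have bM w : 0 <= M w <= B by exact: three_step_bounds.
have aM : {ae P, forall w, 0 <= M w <= B} by exact: nearW.
have rM : \int[P]_w loss (M w) = rho by rewrite /M/= risk_three_step.
have ZM : \int[P]_w (Z w * M w) = w0 by rewrite /M/= budget_three_step.
split.
  apply: bounded_feasible => //; last by rewrite rM.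
  by apply: measurable_wrt_comp; exact: measurable_three_step.
move=> M' /feasible_real[mM' bM' rM' ZM'].
have iM := integ_wealth mM aM; have iM' := integ_wealth mM' bM'.
have lM := integ_loss mM aM; have lM' := integ_loss mM' bM'.
have zM := integ_budget mM aM; have zM' := integ_budget mM' bM'.
apply: objective_le => //.
have lagrangian (X : Omega -> R) : integ X -> integ (fun w => loss (X w)) -> integ (fun w => Z w * X w) ->
    integ (fun w => - X w + la * loss (X w) + et * (Z w * X w)) /\
    \int[P]_w (- X w + la * loss (X w) + et * (Z w * X w)) =
      - (\int[P]_w X w) + la * \int[P]_w loss (X w) + et * \int[P]_w (Z w * X w).
  move=> i1 i2 i3.
  have j1 : integ (fun w => -1 * X w) by exact: (integrableZl _ (-1) i1).
  have j2 : integ (fun w => la * loss (X w)) by exact: (integrableZl _ la i2).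
  have j3 : integ (fun w => et * (Z w * X w)) by exact: (integrableZl _ et i3).
  have j12 : integ (fun w => -1 * X w + la * loss (X w)) by exact: (integrableD _ j1 j2).
  have -> : (fun w => - X w + la * loss (X w) + et * (Z w * X w)) =
      (fun w => -1 * X w + la * loss (X w) + et * (Z w * X w)).
    by apply/funext => w; rewrite mulN1r.
  split; first exact: (integrableD _ j12 j3).
  rewrite (RintegralD _ j12 j3)// (RintegralD _ j1 j2)//.
  by rewrite (RintegralZl _ measurableT i1) (RintegralZl _ measurableT i2) (RintegralZl _ measurableT i3) mulN1r.
have [k1 l1] := lagrangian _ iM lM zM.
have [k2 l2] := lagrangian _ iM' lM' zM'.
have := ae_le_Rintegral k1 k2; rewrite l1 l2 ZM ZM' rM => h.
have {h} : - (\int[P]_w M w) + la * rho + et * w0 <=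
    - (\int[P]_w M' w) + la * \int[P]_w loss (M' w) + et * w0.
  apply: h; apply: filterS bM' => w h.
  exact: (@three_step_minimizes R B alpha c c1' a0 aB la et (Z w) (M' w) la0 la1 et0 h).
have : la * \int[P]_w loss (M' w) <= la * K by rewrite ler_wpM2l.
move: slack; rewrite mulrBr; lra.
Qed.

End problem_solution.

(** * The state-price density of the market *)

(** A set of probability 1 is not empty. *)
Lemma ae_cst {R : realType} {d : measure_display} {Omega : measurableType d}
  (P : probability Omega R) (Q : Prop) : {ae P, forall w : Omega, Q} -> Q.
Proof.
move=> [N [mN PN subN]]; apply: contrapT => nQ.
have : (P setT <= P N)%E by apply: le_measure; rewrite ?inE// => w _; exact: subN.
by rewrite probability_setT PN lee_fin ler10.
Qed.

Section market_theory.
Context {R : realType} {d : measure_display} {Omega : measurableType d}.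
Context {P : probability Omega R} {T : R} {n : nat}.
Variables (mkt : market P T n) (Z : R -> Omega -> R).
Hypothesis hZ : state_price_density mkt Z.
Local Notation leb := (@lebesgue_measure R).
Local Notation W := (mkt_W mkt).
Local Notation F := (brownian_filtration P W).
Local Notation Om := (g_sigma_algebraType (brownian_generators P W T)).
Local Notation r := (mkt_r mkt).
Local Notation theta := (price_of_risk mkt).
Local Notation S0 := (mkt_S0 mkt).
Let U : measurableType _ := measurableTypeR R.

Let T0 : 0 <= T := ltW (mkt_T_gt0 mkt).
Let TT : 0 <= T <= T. Proof. by rewrite T0 lexx. Qed.

Let FTm : F T `<=` measurable.
Proof. by apply: brownian_filtration_measurable; [exact: mkt_complete mkt|case: (mkt_brownian mkt)]. Qed.

Let mr : measurable_fun (`[0, T]%classic `*` setT : set (U * Om)) (fun z => r z.1 z.2).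
Proof. exact: (predictable_measurable T0 (@mkt_r_pred _ _ _ _ _ _ mkt)). Qed.

(** The integral over [0, T] of a progressive process is known at time T. *)
Lemma density_measurable_wrt : measurable_wrt (F T) (Z T).
Proof.
have [I [ptheta mI _] ZE] := hZ TT.
apply: measurable_wrt_ae ZE _; apply/measurable_wrtP.
apply: measurableT_comp => //; apply: measurable_funB; last exact/measurable_wrtP.
apply: measurableT_comp => //.
apply: (@measurable_Rintegral_itv _ Om R T (fun z => r z.1 z.2 + 2^-1 * sqnorm (theta z.1 z.2))).
apply: measurable_funD => //; apply: measurable_funM => //.
by apply: measurable_sum => i; apply: measurable_funM; exact: (progressive_measurable T0 (ptheta i)).
Qed.

Lemma density_measurable : measurable_fun setT (Z T).
Proof. by move=> _ B mB; rewrite setTI; apply: FTm; exact: density_measurable_wrt. Qed.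

Lemma density_gt0 : {ae P, forall w, 0 < Z T w}.
Proof. by have [I _] := hZ TT; apply: filterS => w ->; exact: expR_gt0. Qed.

(** Each component of the excess return is at most 2 k, and ellipticity controls the
inverse of sigma. *)
Lemma price_of_risk_bounded : exists2 c, 0 <= c &
  {ae P, forall w, forall s, 0 <= s <= T -> sqnorm (theta s w) <= c}.
Proof.
have [k hk] := mkt_bounded mkt; have [eps eps0 hell] := mkt_elliptic mkt.
exists (n%:R * (2 * k) ^+ 2 / eps).
  by rewrite mulr_ge0 ?invr_ge0 ?(ltW eps0)// mulr_ge0 ?sqr_ge0.
apply: filterS hell => w hw s sT.
rewrite (le_trans (posdef_price_bound _ eps0 (hw s sT)))// ler_pM2r ?invr_gt0//.
have [rk muk _] := hk s w sT.
rewrite /sqnorm /vdot (@le_trans _ _ (\sum_(i < n) (2 * k) ^+ 2))//; last first.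
  by rewrite big_const_ord iter_addr addr0 -[leLHS]mulr_natl.
apply: ler_sum => i _; rewrite -expr2 -[leLHS]real_normK ?num_real// mxE.
rewrite ler_sqr ?nnegrE//.
  by rewrite (le_trans (ler_normB _ _))//; have := muk i; lra.
by have := normr_ge0 (r s w); lra.
Qed.

Let r_section w : measurable_fun (`[0, T]%classic : set U) (fun s => r s w).
Proof. have h := @measurable_section_itv _ Om R T _ R (fun z => r z.1 z.2) w mr. exact: h. Qed.

(** When S0_T is a constant c, discounting by r is dividing by c / s0, and
what remains of Z is an exponential with expectation 1. *)
Lemma riskless_price : exists2 s0, 0 < s0 &
  {ae P, forall w, forall t, 0 <= t <= T ->
     S0 t w = s0 + \int[leb]_(s in `[0, t]) (r s w * S0 s w)} /\
  forall c, {ae P, forall w, S0 T w = c} -> EZ P (Z T) * c = s0.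
Proof.
have [s0 s00 S0dyn] := mkt_S0_dyn mkt.
exists s0 => //; split => // c S0c.
have [k hk] := mkt_bounded mkt.
have rk w t : 0 <= t <= T -> `|r t w| <= k by move=> /(hk t w)[].
have bank : {ae P, forall w, s0 * expR (\int[leb]_(s in `[0, T]) r s w) = c}.
  apply: filterS3 S0dyn (mkt_S0_cont mkt) S0c => w dyn cont <-.
  exact/esym/(bank_accountE T0 (r_section w) (rk w) cont dyn).
have [I iI ZE] := hZ TT.
have [C C0 thetaC] := price_of_risk_bounded.
have E1 := integral_ito_exponential T0 (mkt_complete mkt) (mkt_brownian mkt) C0 iI thetaC.
have [ptheta mI _] := iI.
have mth w : measurable_fun (`[0, T]%classic : set U) (fun s => sqnorm (theta s w)).
  have mz : measurable_fun (`[0, T]%classic `*` setT : set (U * Om)) (fun z => sqnorm (theta z.1 z.2)).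
    by apply: measurable_sum => i; apply: measurable_funM; exact: (progressive_measurable T0 (ptheta i)).
  have h := @measurable_section_itv _ Om R T _ R (fun z => sqnorm (theta z.1 z.2)) w mz; exact: h.
pose X w := expR (- I w - 2^-1 * \int[leb]_(s in `[0, T]) sqnorm (theta s w)).
have ZX : {ae P, forall w, c * Z T w = s0 * X w}.
  apply: filterS3 ZE bank thetaC => w ZEw bw thw; rewrite -bw ZEw /X.
  have i1 : leb.-integrable `[0, T] (EFin \o (fun s => r s w)).
    exact: (bounded_integrable_itv (r_section w) (rk w)).
  have i2 : leb.-integrable `[0, T] (EFin \o (fun s => sqnorm (theta s w))).
    apply: (bounded_integrable_itv (mth w) (M := C)) => t tT.
    by rewrite ger0_norm ?sqnorm_ge0// thw.
  have i3 : leb.-integrable `[0, T] (EFin \o (fun s => 2^-1 * sqnorm (theta s w))).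
    exact: (integrableZl _ 2^-1 i2).
  rewrite (RintegralD _ i1 i3)// (RintegralZl _ _ i2)//.
  rewrite -mulrA -expRD; congr (_ * expR _); ring.
have mX : measurable_fun setT X.
  apply: measurableT_comp => //; apply: measurable_funB.
    apply: measurableT_comp => // _ B mB; rewrite setTI; apply: FTm; exact: mI.
  apply: measurable_funM => //.
  have mq : measurable_fun (setT : set Om) (fun w => \int[leb]_(s in `[0, T]) sqnorm (theta s w)).
    apply: (@measurable_Rintegral_itv _ Om R T (fun z => sqnorm (theta z.1 z.2))).
    by apply: measurable_sum => i; apply: measurable_funM; exact: (progressive_measurable T0 (ptheta i)).
  by move=> _ B mB; rewrite setTI; apply: FTm; have := mq measurableT B mB; rewrite setTI.
have c0 : 0 < c.
  apply: (ae_cst (P := P)); apply: filterS bank => w <-.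
  by rewrite mulr_gt0// expR_gt0.
have EZc : (\int[P]_w (Z T w)%:E = (s0 / c)%:E)%E.
  rewrite -[RHS]mule1 -E1 -ge0_integralZl_EFin//; last 2 first.
  - exact/measurable_EFinP.
  - by rewrite divr_ge0 ?ltW.
  apply: ae_eq_integral => //.
  - exact/measurable_EFinP/density_measurable.
  - by apply: emeasurable_funM => //; exact/measurable_EFinP.
  apply: filterS ZX => w h _; rewrite -EFinM -/(X w); congr EFin.
  by rewrite mulrAC -h mulrC mulKf// gt_eqF.
by rewrite /EZ unlock EZc/= divfK// gt_eqF.
Qed.

Lemma progressive_cst (x : R) : progressive F T (fun _ _ => x).
Proof.
move=> t tT B mB; apply: sub_sigma_algebra.
have [Bx|nBx] := pselect (B x).
  exists `[0, t]%classic, setT; split; [exact: measurable_itv| |].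
    exact: (@measurableT _ (g_sigma_algebraType (brownian_generators P W t))).
  by apply/seteqP; split => -[s w] /=; rewrite in_itv/= => -[].
exists set0, set0; split => //; first exact: (@measurable0 _ (g_sigma_algebraType (brownian_generators P W t))).
by apply/seteqP; split => -[s w] /= [].
Qed.

Lemma ito_integral0 t : 0 <= t -> ito_integral P T W (fun _ _ => 0) t (fun=> 0).
Proof.
move=> t0; pose h0 : simple_process (R := R) (Omega := Omega) n := SimpleProcess 0 (fun=> 0) (fun _ _ => 0).
have path0 s w : simple_path h0 s w = 0 by rewrite /simple_path big_ord0.
have int0 w : simple_integral W h0 t w = 0 by rewrite /simple_integral big_ord0.
split.
- move=> i; rewrite (_ : (fun s w => (0 : 'cV[R]_n) i 0) = fun _ _ => 0).
    exact: progressive_cst.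
  by apply/funext => s; apply/funext => w; rewrite mxE.
- apply/measurable_wrtP; exact: measurable_cst.
exists (fun=> h0); split.
- by move=> _; split => //; [move=> k _; rewrite lexx|exists 0].
- rewrite (_ : (fun _ => _) = cst 0%E); first exact: cvg_cst.
  apply/funext => m; rewrite integral0_eq// => w _; rewrite integral0_eq// => s _.
  by rewrite path0 subr0 /sqnorm vdotE mulmx0 mxE.
- rewrite (_ : (fun _ => _) = cst 0%E); first exact: cvg_cst.
  by apply/funext => m; rewrite integral0_eq// => w _; rewrite int0 subr0 expr0n.
Qed.

(** Without risky assets, the wealth is a multiple of S0, and the self-financing
equation is the equation of S0 multiplied by w0 / s0. *)
Lemma riskless_self_financing (s0 w0 : R) : 0 < s0 ->
  {ae P, forall w, forall t, 0 <= t <= T ->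
     S0 t w = s0 + \int[leb]_(s in `[0, t]) (r s w * S0 s w)} ->
  self_financing mkt w0 (fun _ _ => w0 / s0) (fun _ _ => 0).
Proof.
move=> s00 dyn.
have [k hk] := mkt_bounded mkt.
have rk w t : 0 <= t <= T -> `|r t w| <= k by move=> /(hk t w)[].
have wealthE t w : wealth mkt (fun _ _ => w0 / s0) (fun _ _ => 0) t w = w0 / s0 * S0 t w.
  by rewrite /wealth /vdot big1 ?addr0// => i _; rewrite mxE mul0r.
have driftE s w : gains_drift mkt (fun _ _ => w0 / s0) (fun _ _ => 0) s w =
    w0 / s0 * (r s w * S0 s w).
  by rewrite /gains_drift big1 ?addr0// => i _; rewrite mxE mul0r.
have diff0 : gains_diffusion mkt (fun _ _ => 0) = (fun _ _ => 0).
  apply/funext => s; apply/funext => w; apply/colP => j; rewrite !mxE big1// => i _.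
  by rewrite mxE mul0r.
have idrift : {ae P, forall w, leb.-integrable `[0, T] (EFin \o (fun s => r s w * S0 s w))}.
  apply: filterS (mkt_S0_cont mkt) => w cont.
  have mS : measurable_fun (`[0, T]%classic : set U) (fun s => S0 s w).
    exact: subspace_continuous_measurable_fun.
  have [K SK] := continuous_bounded_itv T0 cont.
  apply: (bounded_integrable_itv (M := k * K)); first exact: measurable_funM.
  by move=> t tT; rewrite normrM ler_pM// ?SK ?rk.
split.
- exact: progressive_cst.
- move=> i; rewrite (_ : (fun _ _ => _) = fun _ _ => 0); first exact: progressive_cst.
  by apply/funext => s; apply/funext => w; rewrite mxE.
- apply: filterS idrift => w iw.
  rewrite (_ : (fun s => _) = (fun s => (w0 / s0)%:E * (r s w * S0 s w)%:E)%E).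
    exact: integrableZl.
  by apply/funext => s; rewrite driftE.
- apply: filterS dyn => w dw; rewrite wealthE dw ?lexx//.
  by rewrite set_itv1 Rintegral_set1 addr0 divfK// gt_eqF.
move=> t tT; exists (fun=> 0).
  by rewrite diff0; apply: ito_integral0; case/andP: tT.
apply: filterS2 dyn idrift => w dw iw; rewrite wealthE dw// addr0.
rewrite (_ : \int[leb]_(s in `[0, t]) gains_drift _ _ _ _ _ =
    \int[leb]_(s in `[0, t]) (w0 / s0 * (r s w * S0 s w))); last first.
  by apply: eq_Rintegral => s _; exact: driftE.
rewrite RintegralZl//.
  by rewrite mulrDr divfK// gt_eqF.
apply: integrableS iw => //; move=> s /=; rewrite !in_itv/= => /andP[-> st].
by case/andP: tT => _ tT; rewrite (le_trans st tT).
Qed.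

End market_theory.

Theorem theorem2p3 (R : realType) (d : measure_display)
    (Omega : measurableType d) (P : probability Omega R) (T : R) (n : nat)
    (mkt : market P T n) (Zproc : R -> Omega -> R)
    (hZ : state_price_density mkt Zproc)
    (w0 B kappa alpha K : R)
    (hkappa : 2^-1 < kappa < 1) (halpha : 0 < - alpha) (hB : 0 < B + alpha)
    (hH1 : H1_invertible P (Zproc T))
    (hw0 : 0 < w0 < B * EZ P (Zproc T)) :
  let Z := Zproc T in
  let FT := mkt_F mkt T in
  let sol := solves P Z FT w0 B kappa alpha K in
  let M := fun lambda eta => Mstar Z B alpha
             (lower_threshold lambda eta) (upper_threshold kappa lambda eta) in
  let Kl := K_lower P Z w0 B kappa alpha in
  let Ku := K_upper P Z w0 B kappa alpha in
  [/\ Kl < K < Ku ->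
      let good := fun q : R * R =>
        [/\ 0 < q.1 < 1, 0 < q.2,
            multiplier_conditions P Z w0 B kappa alpha K q.1 q.2
          & risk_value P Z B kappa alpha (lower_threshold q.1 q.2)
              (upper_threshold kappa q.1 q.2) = (K - alpha)%:E] in
      (exists! q : R * R, good q) /\ (forall q, good q -> sol (M q.1 q.2)),
      K = Kl -> w0 = - alpha * EZ P Z ->
      exists Msol : Omega -> R,
        [/\ sol Msol,
            forall M', sol M' -> {ae P, forall w, M' w = Msol w},
            {ae P, forall w, Msol w = - alpha}
          & (exists c : R, {ae P, forall w, mkt_S0 mkt T w = c}) ->
            exists phi0 : R -> Omega -> R,
              self_financing mkt w0 phi0 (fun _ _ => 0) /\
              {ae P, forall w, wealth mkt phi0 (fun _ _ => 0) T w = Msol w}],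
      K = Kl -> w0 < - alpha * EZ P Z ->
      sol (M 1 ((1 - kappa) * H1inv P Z (w0 / - alpha))^-1),
      K = Kl -> - alpha * EZ P Z < w0 ->
      sol (Mstar Z B alpha
             (H1inv P Z ((w0 + alpha * EZ P Z) / (B + alpha)))%:E +oo%E)
    & K = Ku -> sol (M 0 (H1inv P Z (w0 / B))^-1)].
Proof.
move=> Z FT sol M Kl Ku.
have /andP[w00 w0B] := hw0.
have B0 : 0 < B by lra.
have e0 : 0 < EZ P Z by rewrite -(pmulr_rgt0 _ B0) (lt_trans w00).
set e := EZ P Z in w0B e0 *.
have mZ := density_measurable hZ; have Z0 := density_gt0 hZ.
have ZFT := density_measurable_wrt hZ.
have /andP[k1 k2] := hkappa.
have k0 : 0 < 1 - kappa by lra.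
have c1 : 1 < (1 - kappa)^-1 by rewrite invf_gt1//; lra.
set c := (1 - kappa)^-1 in c1.
have ck : c * (1 - kappa) = 1 by rewrite /c mulVf// gt_eqF.
have c0 : 0 < c by lra.
have D0 : 0 < - alpha * (c - 1) by rewrite mulr_gt0// subr_gt0.
have AB : B + alpha + - alpha = B by ring.
have dual := @duality_solves R d Omega P Z FT mZ Z0 e0 ZFT w0 B kappa alpha K c1 halpha hB.
have KlE : Kl = if w0 < - alpha * e then - alpha * (c - 1) * (1 - H P Z 0 (H1inv P Z (w0 / - alpha)))
    else (B + alpha) * H P Z 0 (H1inv P Z ((w0 - - alpha * e) / (B + alpha))).
  rewrite /Kl /K_lower -/e -/c; case: ifP => _; first by ring.
  by rewrite mulNr opprK.
have KuE : Ku = (B + alpha) * H P Z 0 (H1inv P Z (w0 / B)) +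
    - alpha * (c - 1) * (1 - H P Z 0 (H1inv P Z (w0 / B))).
  by rewrite /Ku /K_upper -/c; ring.
have w0Be : w0 / B < e by rewrite ltr_pdivrMr// mulrC.
have H1inv_K u : 0 <= u < e -> H P Z 1 (H1inv P Z u) = u by exact: (H1invK hH1).
split.
- move=> KK good.
  have goodP q : 0 < q.1 < 1 -> 0 < q.2 ->
      let a := (1 - q.1) / q.2 in let b := (q.1 * (c - 1) + 1) / q.2 in
      [/\ 0 < a, a < b & good q <->
       (B + alpha) * H P Z 1 a + - alpha * H P Z 1 b = w0 /\
       (B + alpha) * H P Z 0 a + - alpha * (c - 1) * (1 - H P Z 0 b) = K].
    case: q => la et /= /andP[la0 la1] et0.
    have ab : (1 - la) / et < (la * (c - 1) + 1) / et.
      by rewrite ltr_pM2r ?invr_gt0//; have := mulr_gt0 la0 c0; lra.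
    split => //; first by rewrite divr_gt0// subr_gt0.
    have rE := risk_valueE P mZ B kappa alpha (ltW ab).
    have bE := budget_valueE mZ Z0 e0 B alpha (ltW ab).
    split.
      move=> [_ _ [_]]; rewrite /lower_threshold /upper_threshold -/c /= bE rE.
      by move=> [->] [] /eqP; rewrite subr_eq subrK => /eqP.
    move=> [bw rK]; split => //=; rewrite ?la0//.
      by split; rewrite /lower_threshold /upper_threshold -/c ?rE ?bE ?bw ?rK.
    by rewrite /lower_threshold /upper_threshold -/c rE rK.
  split; last first.
    move=> [la et] gq; have [/= la01 et0 _ _] := gq.
    have [a0 ab [/(_ gq)[bw rK] _]] := goodP (la, et) la01 et0.
    have /andP[la0 la1] := la01.
    by apply: dual; rewrite /= ?(ltW la0) ?(ltW la1) -?/c ?rK ?subrr ?mulr0.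
  have w0e : w0 < (B + alpha + - alpha) * e by rewrite AB.
  have := @thresholds_between _ _ _ _ _ mZ Z0 hH1 e0 w0 _ _ (- alpha * (c - 1)) K hB halpha w00 w0e.
  rewrite -KlE AB -KuE => /(_ KK)[a [b [a0 ab bw rK]]].
  have b0 := lt_trans a0 ab.
  (* Solving a eta = 1 - lambda and b eta = 1 + lambda (c - 1) for the multipliers
     gives eta = c / dd and lambda = (b - a) / dd. *)
  pose dd := b + (c - 1) * a.
  have dd0 : 0 < dd by rewrite addr_gt0// mulr_gt0// subr_gt0.
  have q1 : 0 < (b - a) / dd < 1.
    rewrite divr_gt0 ?subr_gt0//= ltr_pdivrMr// mul1r /dd.
    by have := mulr_gt0 c0 a0; lra.
  have q2 : 0 < c / dd by rewrite divr_gt0.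
  have aE : (1 - (b - a) / dd) / (c / dd) = a.
    by rewrite /dd; field; rewrite -/dd !gt_eqF.
  have bE : ((b - a) / dd * (c - 1) + 1) / (c / dd) = b.
    by rewrite /dd; field; rewrite -/dd !gt_eqF.
  exists ((b - a) / dd, c / dd); split.
    by have [_ _ [_]] := goodP ((b - a) / dd, c / dd) q1 q2; rewrite /= aE bE; apply.
  move=> [la et] gq; have [/= la01 et0 _ _] := gq.
  have [a0' ab' [/(_ gq)[bw' rK'] _]] := goodP (la, et) la01 et0.
  rewrite /= in a0' ab' bw' rK'.
  have [aa bb] := thresholds_unique mZ Z0 hH1 e0 hB halpha D0
     a0 b0 a0' (lt_trans a0' ab') bw rK bw' rK'.
  have ddE : dd = c / et by rewrite /dd aa bb; field; rewrite gt_eqF.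
  rewrite /= ddE; congr (_, _).
    by rewrite aa bb; field; rewrite !gt_eqF.
  by field; rewrite !gt_eqF.
- move=> KE w0E.
  have K0 : K = 0.
    rewrite KE KlE -w0E ltxx subrr mul0r (H1inv_0 mZ Z0 hH1 e0).
    by rewrite (H0_0 mZ Z0) mulr0.
  have sM := solves_cst mZ Z0 e0 ZFT c1 halpha hB K0 w0E.
  exists (fun=> - alpha); split => //.
  + move=> M' [fM' _]; exact: (feasible_unique mZ Z0 e0 c1 K0 fM').
  + exact: nearW.
  move=> [s hs]; have [s0 s00 [dyn price]] := riskless_price hZ.
  exists (fun _ _ => w0 / s0); split; first exact: riskless_self_financing.
  have es : e * s = s0 := price s hs.
  apply: filterS hs => w sw.
  rewrite /wealth /vdot big1 ?addr0; last by move=> i _; rewrite mxE mul0r.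
  by rewrite sw mulrAC w0E -(mulrA (- alpha)) es mulfK// gt_eqF.
- move=> KE w0e.
  have u1 : 0 < w0 / - alpha < e by rewrite divr_gt0//= ltr_pdivrMr// mulrC.
  have i0 := H1inv_gt0 mZ Z0 hH1 e0 u1.
  set y := H1inv P Z _ in i0 *.
  have et0 : 0 < ((1 - kappa) * y)^-1 by rewrite invr_gt0 mulr_gt0.
  have aE : (1 - 1) / ((1 - kappa) * y)^-1 = 0 by rewrite subrr mul0r.
  have bE : (1 * (c - 1) + 1) / ((1 - kappa) * y)^-1 = y.
    by rewrite mul1r subrK invrK mulrA ck mul1r.
  apply: dual => //; rewrite -/c aE bE ?(H0_0 mZ Z0) ?mulr0 ?add0r.
  + by rewrite KE KlE w0e.
  + by rewrite KE KlE w0e subrr mulr0.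
  + rewrite (H1_0 mZ Z0 hH1 e0) mulr0 add0r /y H1inv_K; last by case/andP: u1 => /ltW -> ->.
    by rewrite mulrC divfK// gt_eqF.
- move=> KE w0e.
  have nlt : (w0 < - alpha * e) = false by apply/negbTE; rewrite -leNgt ltW.
  apply: (solves_infty mZ Z0 e0 ZFT c1 halpha hB).
    by rewrite KE KlE nlt mulNr opprK.
  rewrite H1inv_K; last first.
    rewrite divr_ge0 ?ltW//=; last by lra.
    by rewrite ltr_pdivrMr//; lra.
  by rewrite mulrC divfK ?gt_eqF// -/e; ring.
- move=> KE.
  have u1 : 0 < w0 / B < e by rewrite divr_gt0.
  have i0 := H1inv_gt0 mZ Z0 hH1 e0 u1.
  set y := H1inv P Z _ in i0 *.
  have et0 : 0 < y^-1 by rewrite invr_gt0.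
  have aE : (1 - 0) / y^-1 = y by rewrite subr0 invrK mul1r.
  have bE : (0 * (c - 1) + 1) / y^-1 = y by rewrite mul0r add0r invrK mul1r.
  apply: dual => //; rewrite -/c ?aE ?bE.
  + by rewrite KE KuE.
  + by rewrite mul0r.
  + rewrite -mulrDl AB /y H1inv_K; last by case/andP: u1 => /ltW -> ->.
    by rewrite mulrC divfK// gt_eqF.
Qed.
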